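(* A finite dualisable regular semigroup $\mathbf{S}$ must be a normal band of groups, with each $\mathcal{J}$-class isomorphic to the direct product of a rectangular band with a group whose Sylow subgroups are abelian.
   Context: A semigroup is regular if for every $s$ there is $t$ with $sts=s$. A band is a semigroup all of whose elements are idempotent; a normal band is a band satisfying $xyzx\approx xzyx$. A semigroup is a normal band of groups if it has a congruence all of whose classes are subgroups and whose quotient is a normal band. A rectangular band is a semigroup isomorphic to $I\times\Lambda$ with multiplication $(i,\lambda)(j,\rho)=(i,\rho)$. In a semigroup, $a$ divides $b$ if $cad=b$ for some $c,d$ (each an element of the semigroup or empty); $\mathcal{J}$-classes are the equivalence classes of the preorder ''divides''. Semigroups are algebras with a single binary operation. Duality notions. Let $\mathbf{M}$ be a finite algebra and $\mathcal{Q}=\mathsf{ISP}(\mathbf{M})$ the quasivariety it generates (isomorphic copies of subalgebras of direct powers of $\mathbf{M}$). An alter ego $\mathbb{M}$ of $\mathbf{M}$ is a structure on the same universe $M$, carrying the discrete topology and some finitary operations, partial operations and relations, such that each $n$-ary operation is a homomorphism $\mathbf{M}^n\to\mathbf{M}$, each $n$-ary relation is a subalgebra of $\mathbf{M}^n$, and each $n$-ary partial operation is a homomorphism from a subalgebra of $\mathbf{M}^n$ into $\mathbf{M}$. Let $\mathcal{X}=\mathsf{IS_cP^+}(\mathbb{M})$ be the class of topologically and algebraically isomorphic copies of closed substructures of powers of $\mathbb{M}$ over nonempty index sets (product topology, pointwise structure). For $\mathbf{A}\in\mathcal{Q}$, $D(\mathbf{A})=\hom(\mathbf{A},\mathbf{M})$,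 a closed substructure of $\mathbb{M}^A$; for $\mathbb{A}\in\mathcal{X}$, $E(\mathbb{A})$ is the algebra of continuous homomorphisms (structure-preserving maps) $\mathbb{A}\to\mathbb{M}$, a subalgebra of $\mathbf{M}^{\mathbb{A}}$. $\mathbb{M}$ yields a duality on $\mathbf{A}$ if the (always injective) evaluation homomorphism $e:\mathbf{A}\to E(D(\mathbf{A}))$, $e_a(x)=x(a)$, is an isomorphism. $\mathbf{M}$ is dualisable (admits a natural duality) if some alter ego of $\mathbf{M}$ yields a duality on every $\mathbf{A}\in\mathcal{Q}$. *)

(* Defs.v *)
From HB Require Import structures.
From mathcomp Require Import all_boot all_fingroup all_solvable.
From mathcomp Require Import boolp classical_sets functions cardinality.
From mathcomp Require Import topology generic_quotient.

Set Implicit Arguments.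
Unset Strict Implicit.
Unset Printing Implicit Defensive.

Local Open Scope classical_set_scope.
Local Open Scope group_scope.
Local Open Scope quotient_scope.

Definition is_hom (A B : semigroupType) (f : A -> B) : Prop :=
  {morph f : x y / x * y}.

Definition subalgebra (A : semigroupType) (X : set A) : Prop :=
  forall x y, X x -> X y -> X (x * y).

(* [f] is an isomorphism from [A] onto the subsemigroup [X] of [B]; for such an
   [f] the set [X] is automatically closed under multiplication. *)
Definition iso_onto (A B : semigroupType) (f : A -> B) (X : set B) : Prop :=
  is_hom f /\ set_bij [set: A] X f.

Definition semigroup_power (I : Type) (A : semigroupType) : Type := I -> A.

Section Power.
Variables (I : Type) (A : semigroupType).

Definition semigroup_power_mul (x y : semigroup_power I A) : semigroup_power I A :=
  fun i => x i * y i.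

Lemma semigroup_power_mulA : associative semigroup_power_mul.
Proof. by move=> x y z; apply/funext => i; exact: mulgA. Qed.

HB.instance Definition _ := Choice.copy (semigroup_power I A) (I -> A).
HB.instance Definition _ :=
  isSemigroup.Build (semigroup_power I A) semigroup_power_mulA.
End Power.

Definition semigroup_prod (A B : semigroupType) : Type := (A * B)%type.

Section DirectProduct.
Variables A B : semigroupType.

Definition semigroup_prod_mul (x y : semigroup_prod A B) :
  semigroup_prod A B := (x.1 * y.1, x.2 * y.2).

Lemma semigroup_prod_mulA : associative semigroup_prod_mul.
Proof. by move=> x y z; rewrite /semigroup_prod_mul /= !mulgA. Qed.

HB.instance Definition _ := Choice.copy (semigroup_prod A B) (A * B)%type.
HB.instance Definition _ :=
  isSemigroup.Build (semigroup_prod A B) semigroup_prod_mulA.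
End DirectProduct.

Definition rectangle (I L : choiceType) : Type := (I * L)%type.

Section Rectangle.
Variables I L : choiceType.

Definition rectangle_mul (x y : rectangle I L) : rectangle I L := (x.1, y.2).

Lemma rectangle_mulA : associative rectangle_mul.
Proof. by []. Qed.

HB.instance Definition _ := Choice.copy (rectangle I L) (I * L)%type.
HB.instance Definition _ := isSemigroup.Build (rectangle I L) rectangle_mulA.
End Rectangle.

Record congruence (S : semigroupType) := Congruence {
  cong_rel :> equiv_rel S;
  cong_mul : forall x x' y y',
    cong_rel x x' -> cong_rel y y' -> cong_rel (x * y) (x' * y') }.

Definition quotient_semigroup (S : semigroupType) (th : congruence S) : Type :=
  {eq_quot th}.

Section Quotient.
Variables (S : semigroupType) (th : congruence S).

Definition quotient_mul (x y : quotient_semigroup th) : quotient_semigroup th :=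
  \pi_{eq_quot th} (repr x * repr y).

Lemma quotient_mul_pi (x y : S) :
  quotient_mul (\pi_{eq_quot th} x) (\pi_{eq_quot th} y) =
  \pi_{eq_quot th} (x * y).
Proof.
apply/eqP; rewrite eqmodE; apply: cong_mul; rewrite -eqmodE; apply/eqP;
exact: reprK.
Qed.

Lemma quotient_mulA : associative quotient_mul.
Proof.
have piE (u : quotient_semigroup th) : exists a, u = \pi_{eq_quot th} a.
  by exists (repr u); rewrite reprK.
move=> x y z; have [[a ->] [b ->] [c ->]] := And3 (piE x) (piE y) (piE z).
by rewrite !quotient_mul_pi mulgA.
Qed.

HB.instance Definition _ := Choice.copy (quotient_semigroup th) {eq_quot th}.
HB.instance Definition _ :=
  isSemigroup.Build (quotient_semigroup th) quotient_mulA.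
End Quotient.

Definition regular_semigroup (S : semigroupType) : Prop :=
  forall s : S, exists t : S, s * t * s = s.

Definition band (S : semigroupType) : Prop := forall x : S, x * x = x.

Definition normal_band (S : semigroupType) : Prop :=
  band S /\ forall x y z : S, x * y * z * x = x * z * y * x.

Definition is_subgroup (S : semigroupType) (G : set S) : Prop :=
  subalgebra G /\
  exists2 e : S, G e & forall x, G x ->
    [/\ e * x = x, x * e = x & exists2 y, G y & x * y = e /\ y * x = e].

Definition normal_band_of_groups (S : semigroupType) : Prop :=
  exists th : congruence S,
    (forall a, is_subgroup [set b | th a b]) /\
    normal_band (quotient_semigroup th).

Definition rectangular_band (B : semigroupType) : Prop :=
  exists (I L : choiceType) (f : rectangle I L -> B), iso_onto f [set: B].

(* [c] and [d] range over [S] or are empty. *)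
Definition divides (S : semigroupType) (a b : S) : Prop :=
  exists c d : option S,
    let ca := if c is Some c' then c' * a else a in
    (if d is Some d' then ca * d' else ca) = b.

Definition J_class (S : semigroupType) (a : S) : set S :=
  [set b | divides a b /\ divides b a].

Definition abelian_sylows (gT : finGroupType) : Prop :=
  forall (p : nat) (P : {group gT}),
    prime p -> p.-Sylow([set: gT]%G) P -> abelian P.

Record signature := Signature {
  op_name : Type;
  op_arity : op_name -> nat;
  pop_name : Type;
  pop_arity : pop_name -> nat;
  rel_name : Type;
  rel_arity : rel_name -> nat }.

(* The topology is not part of the record: it is carried by the type [X]. *)
Record structure (L : signature) (X : Type) := Structure {
  op : forall o : op_name L, {ffun 'I_(op_arity o) -> X} -> X;
  pop_dom : forall o : pop_name L, set {ffun 'I_(pop_arity o) -> X};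
  pop : forall o : pop_name L, @pop_dom o -> X;
  srel : forall r : rel_name L, set {ffun 'I_(rel_arity r) -> X} }.

Arguments op {L X} s o _.
Arguments pop_dom {L X} s o _.
Arguments pop {L X} s o _.
Arguments srel {L X} s r _.

Definition tmap (X Y : Type) (f : X -> Y) (n : nat) (t : {ffun 'I_n -> X}) :
  {ffun 'I_n -> Y} := [ffun k => f (t k)].

Definition tcoord (I X : Type) (n : nat) (t : {ffun 'I_n -> (I -> X)}) (i : I) :
  {ffun 'I_n -> X} := tmap (fun x => x i) t.

Section Constructions.
Variables (L : signature) (X : Type) (N : structure L X).

Section PowerStructure.
Variable I : Type.

Definition power_pop_dom (o : pop_name L) :
  set {ffun 'I_(pop_arity o) -> (I -> X)} :=
  [set t | forall i, pop_dom N o (tcoord t i)].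

Definition power_pop_arg (o : pop_name L) (t : @power_pop_dom o) (i : I) :
  pop_dom N o := exist _ (tcoord (val t) i) (mem_set (set_valP t i)).

Definition power_structure : structure L (I -> X) :=
  {| op := fun o t i => op N o (tcoord t i);
     pop_dom := @power_pop_dom;
     pop := fun o t i => pop N o (power_pop_arg t i);
     srel := fun r => [set t | forall i, srel N r (tcoord t i)] |}.
End PowerStructure.

Definition closed_under (Y : set X) : Prop :=
  (forall o (t : {ffun 'I_(op_arity o) -> X}),
     (forall k, Y (t k)) -> Y (op N o t)) /\
  (forall o (t : pop_dom N o),
     (forall k, Y (val t k)) -> Y (pop N o t)).

Section SubStructure.
Variables (Y : set X) (clY : closed_under Y).

Lemma sub_tupleP (n : nat) (t : {ffun 'I_n -> Y}) k : Y (tmap val t k).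
Proof. by rewrite ffunE; exact: set_valP. Qed.

Definition sub_pop_dom (o : pop_name L) : set {ffun 'I_(pop_arity o) -> Y} :=
  [set t | pop_dom N o (tmap val t)].

Definition sub_pop_arg (o : pop_name L) (t : @sub_pop_dom o) : pop_dom N o :=
  exist _ (tmap val (val t)) (mem_set (set_valP t)).

Definition sub_structure : structure L Y :=
  {| op := fun o t =>
       exist _ (op N o (tmap val t)) (mem_set (clY.1 o _ (sub_tupleP t)));
     pop_dom := @sub_pop_dom;
     pop := fun o t =>
       exist _ (pop N o (sub_pop_arg t))
         (mem_set (clY.2 o (sub_pop_arg t) (sub_tupleP (val t))));
     srel := fun r => [set t | srel N r (tmap val t)] |}.
End SubStructure.
End Constructions.

Definition structure_preserving (L : signature) (X Y : Type)
    (NX : structure L X) (NY : structure L Y) (f : X -> Y) : Prop :=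
  [/\ forall o t, f (op NX o t) = op NY o (tmap f t),
      forall o (t : pop_dom NX o),
        exists t' : pop_dom NY o,
          val t' = tmap f (val t) /\ f (pop NX o t) = pop NY o t' &
      forall r t, srel NX r t -> srel NY r (tmap f t)].

(* The powers [M^n] are the library semigroups [{ffun 'I_n -> M}]. *)
Definition alter_ego (M : semigroupType) (L : signature) (N : structure L M) :
    Prop :=
  [/\ forall o, is_hom (op N o),
      forall o, subalgebra (pop_dom N o),
      forall o (s t st : pop_dom N o),
        val st = val s * val t -> pop N o st = pop N o s * pop N o t &
      forall r, subalgebra (srel N r)].

Definition in_ISP (M A : semigroupType) : Prop :=
  exists (I : Type) (X : set (semigroup_power I M))
    (f : A -> semigroup_power I M),
    subalgebra X /\ iso_onto f X.

(* [hom(A, M)] as a subspace of the topological product of discrete spaces. *)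
Definition homs (A M : semigroupType) : set {ptws A -> discrete_topology M} :=
  [set h | @is_hom A M h].
Arguments homs : clear implicits.

Lemma homs_closed_under (M : semigroupType) (L : signature) (N : structure L M)
    (A : semigroupType) :
  alter_ego N -> closed_under (power_structure N A) (homs A M).
Proof.
move=> [opN popDN popN _]; split => o t tH x y /=.
  rewrite -opN; congr (op N o _); apply/ffunP => k.
  by rewrite !ffunE tH.
apply: popN; apply/ffunP => k.
by rewrite !ffunE /= tH.
Qed.

Definition dual_structure (M : semigroupType) (L : signature)
    (N : structure L M) (aeN : alter_ego N) (A : semigroupType) :
    structure L (homs A M) :=
  sub_structure (homs_closed_under A aeN).

Definition continuous_homs (M : semigroupType) (L : signature)
    (N : structure L M) (X : topologicalType) (NX : structure L X) :
    set (semigroup_power X M) :=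
  [set f | continuous (f : X -> discrete_topology M) /\
           structure_preserving NX N f].

Definition evaluation (A M : semigroupType) (a : A) :
  semigroup_power (homs A M) M :=
  fun x => (val x : A -> M) a.

Definition yields_duality_on (M : semigroupType) (L : signature)
    (N : structure L M) (aeN : alter_ego N) (A : semigroupType) : Prop :=
  iso_onto (@evaluation A M)
    (@continuous_homs M L N (homs A M) (dual_structure aeN A)).

(* Algebras are nonempty. *)
Definition dualisable (M : semigroupType) : Prop :=
  exists (L : signature) (N : structure L M) (aeN : alter_ego N),
    forall A : semigroupType,
      [set: A] !=set0 -> in_ISP M A -> yields_duality_on aeN A.

(* Main.v *)
(** Non-dualisability is always proved with a ghost element.  Take a subsemigroup
    [X] of a power [S^I] and a sequence [z k] in [X] such that every homomorphism
    [X -> S], in particular every projection, is constant on the sequence up to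
    a uniformly bounded number of exceptions.  Sending a homomorphism to this
    majority value is continuous, and agrees with an evaluation on every finite
    set of homomorphisms, hence preserves the structure of any alter ego; if [S]
    is dualisable it is an evaluation, so the pointwise limit [J] of the [z k]
    belongs to [X].  The bounded number of exceptions comes from the pigeonhole
    principle: a homomorphism into [S] takes at most [#|S|] values on auxiliary
    elements of [X], and each coincidence of values makes it identify two [z k].

    Subsemigroups that miss [J] exist as soon as [S] contains a regular element
    outside all subgroups, a two-element left or right zero band with an
    identity adjoined, idempotents [g R e L h] with [g h <> e], or a subgroup
    with a non-trivial central commutator.  A finite dualisable regular [S]
    contains none of these.  So it is completely regular, its idempotents form a
    normal band, [x |-> x x^-1] is a homomorphism onto that band whose kernel
    classes are groups, each J-class is a rectangular band times a group, and
    nilpotent subgroups, in particular Sylow subgroups, are abelian. *)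

Require Import Defs.
From HB Require Import structures.
From mathcomp Require Import all_boot all_fingroup all_solvable.
From mathcomp Require Import ssralg zmodp generic_quotient.
From mathcomp Require Import mathcomp_extra boolp classical_sets functions cardinality filter.
From mathcomp Require Import topology.

Set Implicit Arguments.
Unset Strict Implicit.
Unset Printing Implicit Defensive.

(** * Bounded and infinite sets of indices *)

Definition small (c : nat) (P : pred nat) : Prop :=
  forall s : seq nat, uniq s -> all P s -> size s <= c.

Definition frequently (P : pred nat) : Prop := forall m, exists2 k, m <= k & P k.

Lemma sub_small c (P Q : pred nat) : subpred P Q -> small c Q -> small c P.
Proof. by move=> PQ sQ s us /(sub_all PQ); apply: sQ. Qed.

Lemma small_count c (P : pred nat) s : small c P -> uniq s -> count P s <= c.
Proof.
by move=> sP us; rewrite -size_filter; apply: sP; rewrite ?filter_uniq ?filter_all.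
Qed.

Lemma frequentlyT : frequently predT.
Proof. by move=> m; exists m. Qed.

Lemma frequently_uniq (P : pred nat) n :
  frequently P -> exists s, [/\ uniq s, all P s & size s = n].
Proof.
move=> fP; elim: n => [|n [s [us sP <-]]]; first by exists [::].
have [k lek Pk] := fP (\max_(i <- s) i).+1.
exists (k :: s); split=> //=; last by rewrite Pk.
rewrite us andbT; apply: contraL lek => ks.
by rewrite -leqNgt (big_rem k ks) /= leq_maxl.
Qed.

Lemma small_predU c d (P Q : pred nat) : small c P -> small d Q -> small (c + d) (predU P Q).
Proof.
move=> sP sQ s us; rewrite all_count => /eqP <-.
apply: leq_trans (leq_addr (count (predI P Q) s) _) _.
by rewrite count_predUI leq_add ?small_count.
Qed.

Lemma small_has (T : eqType) c (bad : T -> pred nat) (X : seq T) :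
  (forall x, x \in X -> small c (bad x)) ->
  small (c * size X) (fun k => has (bad^~ k) X).
Proof.
elim: X => [|x X IH] sX /=; first by rewrite muln0 => -[|k s].
rewrite mulnS; apply: (@small_predU _ _ (bad x) (fun k => has (bad^~ k) X)).
  by apply: sX; rewrite mem_head.
by apply: IH => y yX; apply: sX; rewrite inE yX orbT.
Qed.

(** The exceptions of the finitely many [x] together form a set of bounded size, whereas [P]
    contains duplicate-free lists of every length. *)
Lemma frequently_avoid (T : eqType) c (bad : T -> pred nat) (P : pred nat) (X : seq T) :
  frequently P -> (forall x, x \in X -> small c (bad x)) ->
  exists2 k, P k & forall x, x \in X -> ~~ bad x k.
Proof.
move=> fP sX; have [s [us sP sz]] := frequently_uniq (c * size X).+1 fP.
have : ~~ all (fun k => has (bad^~ k) X) s.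
  by apply/negP => /(small_has sX us); rewrite sz ltnn.
case/allPn => k ks /hasPn kb; exists k => //.
by move/allP: sP; apply.
Qed.

Lemma small_existsN c (P : pred nat) : small c P -> exists k, ~~ P k.
Proof.
move=> sP; have : ~~ all P (iota 0 c.+1).
  by apply/negP => /(sP _ (iota_uniq _ _)); rewrite size_iota ltnn.
by case/allPn => k _ Pk; exists k.
Qed.

(** * Maps into a finite set that are constant up to boundedly many exceptions *)

Section FiniteCount.
Variables (S : choiceType).
Hypothesis S_fin : finite_set [set: S]%classic.

Lemma finite_enum : exists s : seq S, forall x, x \in s.
Proof.
have /finite_seqP[s sE] := S_fin; exists s => x.
have : [set: S]%classic x by [].
by rewrite sE.
Qed.

Lemma finite_bound : exists h, forall s : seq S, uniq s -> size s <= h.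
Proof.
have [e eP] := finite_enum; exists (size e) => s us.
by apply: uniq_leq_size => // x _.
Qed.

Lemma finite_frequently (f : nat -> S) : exists v, frequently (fun k => f k == v).
Proof.
apply/not_existsP => nf; have [e eP] := finite_enum.
have /choice[N NP] : forall v, exists m, forall k, m <= k -> f k != v.
  move=> v; have /existsNP[m mP] := nf v; exists m => k lek.
  by apply/negP => fk; apply: mP; exists k.
pose m := \max_(v <- e) N v.
have leN v : N v <= m by rewrite /m (big_rem v) //= leq_maxl.
by have := NP (f m) m (leN _); rewrite eqxx.
Qed.

(* Take [v] with [f k = v] for infinitely many [k], and among these a [k] such that
   [g j k = f j] for every [j] in a finite set where [f j <> v].  Then
   [g k j = g j k = f j <> f k], so all these [j] are exceptions for [k]. *)
Lemma almost_constant_of_swap h (f : nat -> S) (g xi : nat -> nat -> S) :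
  (forall s : seq S, uniq s -> size s <= h) ->
  (forall j k, g j k = g k j) ->
  (forall j k l, k != j -> l != j -> k != l -> xi j k = xi j l -> g j k = f j) ->
  exists v, small h.+1 (fun k => f k != v).
Proof.
move=> hP gC xiP; have [v fv] := finite_frequently f; exists v => s us sP.
pose bad j : pred nat := fun k => g j k != f j.
have badP j : small h.+1 (bad j).
  move=> t ut tP; have ut' := rem_uniq j ut.
  have tP' k : k \in rem j t -> (k != j) && bad j k.
    by rewrite mem_rem_uniq // inE => /andP[-> /(allP tP)].
  have uxi : uniq [seq xi j k | k <- rem j t].
    rewrite map_inj_in_uniq // => k l kt lt exi; apply/eqP/negP => nkl.
    have [/andP[kj kb] /andP[lj _]] := (tP' _ kt, tP' _ lt).
    by move/negP: nkl => nkl; rewrite /bad (xiP j k l) ?eqxx in kb.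
  have := hP _ uxi; rewrite size_map.
  have [jt|jt] := boolP (j \in t).
    by rewrite size_rem //; case: (size t).
  by rewrite rem_id //; exact: leqW.
have [k /eqP fk kP] := frequently_avoid fv (fun j (_ : j \in s) => badP j).
apply: (badP k) us _; apply/allP => j js.
have := kP j js; rewrite negbK => /eqP gjk.
by rewrite /bad gC gjk fk; exact: (allP sP).
Qed.

(** Let [g] take the value [v] infinitely often. Pairing the exceptions of [f] with distinct indices
    where [g] equals [v] makes the values of [xi] pairwise distinct, for a coincidence would give
    [f k = v]. *)
Lemma almost_constant_of_pairs h (f g : nat -> S) (xi : nat -> nat -> S) :
  (forall s : seq S, uniq s -> size s <= h) ->
  (forall k l k' l', k != k' -> l != l' -> xi k l = xi k' l' -> f k = g l) ->
  exists v, small h (fun k => f k != v).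
Proof.
move=> hP xiP; have [v gv] := finite_frequently g; exists v => s us sP.
have [t [ut tP st]] := frequently_uniq (size s) gv.
pose l i := nth 0 t i; pose k i := nth 0 s i.
have := hP [seq xi (k i) (l i) | i <- iota 0 (size s)].
rewrite size_map size_iota; apply.
rewrite map_inj_in_uniq ?iota_uniq // => i j.
rewrite !mem_iota !add0n => /andP[_ ilt] /andP[_ jlt] exi; apply/eqP/negP => nij.
have := allP sP (k i) (mem_nth _ ilt); rewrite (xiP _ (l i) _ _ _ _ exi).
- by rewrite (eqP (allP tP (l i) _)) ?eqxx ?mem_nth ?st.
- by rewrite nth_uniq //; apply/negP.
- by rewrite nth_uniq ?st //; apply/negP.
Qed.

End FiniteCount.

(** * Subsemigroups and the ghost element *)

Section Subsemigroup.
Local Open Scope classical_set_scope.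
Local Open Scope group_scope.
Variables (A : semigroupType) (X : set A).

Definition subsemigroup (clX : subalgebra X) : Type := X.

Hypothesis clX : subalgebra X.

Definition subsemigroup_mul (x y : subsemigroup clX) : subsemigroup clX :=
  exist _ (val x * val y) (mem_set (clX (set_valP x) (set_valP y))).

Lemma subsemigroup_mulA : associative subsemigroup_mul.
Proof. by move=> x y z; apply/val_inj; exact: mulgA. Qed.

HB.instance Definition _ := Choice.copy (subsemigroup clX) X.
HB.instance Definition _ := isSemigroup.Build (subsemigroup clX) subsemigroup_mulA.

End Subsemigroup.

Section Ghost.
Local Open Scope classical_set_scope.
Local Open Scope group_scope.
Variable S : semigroupType.

(* [u] is determined by its argument on [z 0, ..., z (2c)], which gives
   continuity, and coincides with evaluation at some [z k] on any finite set. *)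
Lemma ghost_is_evaluation (A : semigroupType) c (z : nat -> A) (u : (A -> S) -> S) :
  dualisable S -> [set: A] !=set0 -> in_ISP S A ->
  (forall h : A -> S, is_hom h -> small c (fun k => h (z k) != u h)) ->
  exists a, forall h : A -> S, is_hom h -> h a = u h.
Proof.
move=> [L [N [aeN dual]]] A0 ispA uP.
pose bad (x : homs A S) : pred nat := fun k => (val x : A -> S) (z k) != u (val x).
have badP x : small c (bad x) by apply: uP; exact: set_valP.
have good (X : seq (homs A S)) :
    exists k, forall x, x \in X -> (val x : A -> S) (z k) = u (val x).
  have [k _ kP] := frequently_avoid frequentlyT (fun x (_ : x \in X) => badP x).
  by exists k => x /kP; rewrite negbK => /eqP.
have [_ [_ _ surj]] := dual A A0 ispA.
have [a _ aP] : exists2 a, [set: A] a &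
    evaluation a = (fun x : homs A S => u (val x)) :> semigroup_power (homs A S) S.
  apply: surj; split.
    move=> x0; apply/discrete_cvg; first exact: (fmap_filter _ (nbhs_filter x0)).
    have agree : \forall x \near x0, forall i : 'I_(c + c).+1,
        (val x : A -> S) (z i) = (val x0 : A -> S) (z i).
      pose agr (i : 'I_(c + c).+1) : set (homs A S) :=
        [set x | (val x : A -> S) (z i) = (val x0 : A -> S) (z i)].
      apply: (@filter_forall _ _ agr (nbhs x0)) => i.
      have evC : continuous (fun x : homs A S => (val x : A -> discrete_topology S) (z i)).
        move=> y; apply: (@continuous_comp _ _ _ (@set_val _ (homs A S)) (proj (z i))).
          exact: initial_continuous.
        exact: proj_continuous.
      exact: (evC x0 _ (discrete_set1 _)).
    apply: filterS agree => x xE /=.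
    (* At most [2c] of these [2c + 1] indices are exceptions for [x] or [x0]; any other one
       determines [u] at both. *)
    have : ~~ all (predU (bad x) (bad x0)) (iota 0 (c + c).+1).
      apply/negP => /(small_predU (badP x) (badP x0) (iota_uniq _ _)).
      by rewrite size_iota ltnn.
    case/allPn => k; rewrite mem_iota add0n => /andP[_ lek] /=.
    by rewrite negb_or !negbK => /andP[/eqP <- /eqP <-]; exact: (xE (Ordinal lek)).
  split.
  - move=> o t; have [k kP] := good
      (op (dual_structure aeN A) o t :: [seq t i | i <- enum 'I_(op_arity o)]).
    rewrite -(kP _ (mem_head _ _)); congr (op N o _); apply/ffunP => i.
    by rewrite !ffunE -kP ?inE ?map_f ?orbT ?mem_enum.
  - move=> o t; have [k kP] := good
      (pop (dual_structure aeN A) o t :: [seq val t i | i <- enum 'I_(pop_arity o)]).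
    exists (power_pop_arg (sub_pop_arg t) (z k)); split; last first.
      by rewrite -(kP _ (mem_head _ _)).
    by apply/ffunP => i; rewrite !ffunE -kP ?inE ?map_f ?orbT ?mem_enum.
  - move=> r t tr; have [k kP] := good [seq t i | i <- enum 'I_(rel_arity r)].
    have := tr (z k); congr (srel N r _); apply/ffunP => i.
    by rewrite !ffunE -kP ?map_f ?mem_enum.
exists a => h hh.
pose x : homs A S := exist _ h (mem_set hh).
by rewrite -[u h]/(u (val x)) -(congr1 (fun f => f x) aP).
Qed.

(** The majority values form a ghost [u], which is evaluation at some [a] in [X]; on the projections
    [u] gives the coordinates of [J], so [a = J]. *)
Lemma limit_in_subsemigroup (I : Type) (X : set (semigroup_power I S)) c
    (z : nat -> semigroup_power I S) (J : semigroup_power I S) :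
  dualisable S -> subalgebra X -> (forall k, X (z k)) ->
  (forall i, small c (fun k => z k i != J i)) ->
  (forall h : semigroup_power I S -> S,
     (forall x y, X x -> X y -> h (x * y) = h x * h y) ->
     exists v, small c (fun k => h (z k) != v)) ->
  X J.
Proof.
move=> dS clX zX zJ hX; pose A := subsemigroup clX.
pose w k : A := exist _ (z k) (mem_set (zX k)).
have AP : in_ISP S A.
  exists I, X, (fun x : A => val x); split=> //; split=> //; split.
  - by move=> x _; exact: set_valP.
  - by move=> x y _ _; exact: val_inj.
  - by move=> x Xx; exists (exist _ x (mem_set Xx) : A).
have [u uP] : exists u : (A -> S) -> S, forall h, is_hom h -> small c (fun k => h (w k) != u h).
  suff /choice[u uP] : forall h : A -> S,
      exists v, is_hom h -> small c (fun k => h (w k) != v) by exists u.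
  move=> h; have [hh|nh] := pselect (is_hom h); last by exists (h (w 0)).
  (* The premise on homomorphisms speaks of maps on the whole power, so [h] is extended by a dummy
     value outside [X]. *)
  pose h' x := if pselect (X x) is left Xx then h (exist _ x (mem_set Xx)) else h (w 0).
  have h'E x (Xx : X x) : h' x = h (exist _ x (mem_set Xx)).
    by rewrite /h'; case: pselect => // Xx'; congr h; exact: val_inj.
  have [x y Xx Xy|v vP] := hX h'.
    by rewrite (h'E _ (clX _ _ Xx Xy)) !h'E -hh; congr h; exact: val_inj.
  exists v => _; apply: sub_small vP => k; rewrite h'E.
  by rewrite (_ : exist _ _ _ = w k) //; exact: val_inj.
have A0 : [set: A] !=set0 by exists (w 0).
have [a aP] := ghost_is_evaluation dS A0 AP uP.
rewrite (_ : J = val a); first exact: set_valP.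
apply/funext => i; pose h (x : A) := val x i.
have hh : is_hom h by [].
rewrite -[RHS]/(h a) aP //.
have [k] := small_existsN (small_predU (zJ i) (uP h hh)).
by rewrite /= negb_or !negbK => /andP[/eqP <- /eqP <-].
Qed.

End Ghost.

(** * Powers in a finite semigroup *)

Section Powers.
Local Open Scope group_scope.
Variable S : semigroupType.

(* Semigroups lack a unit, so [spow x n] is the power of exponent [n + 1]. *)
Fixpoint spow (x : S) (n : nat) : S := if n is m.+1 then x * spow x m else x.

Lemma spowD x m n : spow x m * spow x n = spow x (m + n).+1.
Proof. by elim: m => [//|m IH]; rewrite /= -mulgA IH. Qed.

Lemma spowSr x n : spow x n.+1 = spow x n * x.
Proof. by rewrite (spowD x n 0) addn0. Qed.

Lemma spow_eq_shift x i d k : spow x i = spow x (i + d) -> i <= k -> spow x k = spow x (k + d).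
Proof.
move=> eid /subnKC <-; elim: (k - i) => [|m IH]; first by rewrite addn0.
by rewrite addnS spowSr IH addSn spowSr.
Qed.

Lemma spow_eq_shiftM x i d k q :
  spow x i = spow x (i + d) -> i <= k -> spow x k = spow x (k + q * d).
Proof.
move=> eid lek; elim: q => [|q IH]; first by rewrite addn0.
rewrite IH mulSnr addnA; apply: spow_eq_shift eid _.
exact: leq_trans (leq_addr _ _).
Qed.

(** Preperiods and periods are bounded by [h], so the exponent [(h + 1)!] lies beyond every
    preperiod and is a multiple of every period. The predecessor in the witness makes up for the
    shift in [spow]. *)
Lemma finite_idempotent_power :
  finite_set [set: S]%classic -> exists n, forall x : S, spow x n * spow x n = spow x n.
Proof.
move=> Sfin; have [h hP] := finite_bound Sfin.
exists h.+1`!.-1 => x.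
have [i [d [d0 led eid]]] : exists i d, [/\ 0 < d, i + d <= h & spow x i = spow x (i + d)].
  have : ~~ uniq [seq spow x i | i <- iota 0 h.+1].
    by apply/negP => /hP; rewrite size_map size_iota ltnn.
  case/(uniqPn x) => i [j [ij]]; rewrite size_map size_iota => jh.
  rewrite !(nth_map 0) ?size_iota // ?nth_iota ?(ltn_trans ij) // => e.
  exists i, (j - i); rewrite subnKC ?(ltnW ij) //; split=> //.
  by rewrite subn_gt0.
have [q qE] : exists q, h.+1`! = (q * d)%N.
  by apply/dvdnP; apply: dvdn_fact; rewrite d0 (leqW (leq_trans (leq_addl i d) led)).
have fE : h.+1`!.-1.+1 = h.+1`! by rewrite prednK ?fact_gt0.
rewrite spowD -addnS fE qE; symmetry; apply: spow_eq_shiftM eid _.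
rewrite -ltnS -qE fE factS.
have le1 : i < h.+1 by rewrite ltnS (leq_trans _ led) ?leq_addr.
by apply: leq_trans le1 _; rewrite leq_pmulr ?fact_gt0.
Qed.

End Powers.

Lemma spow_power (S : semigroupType) (I : Type) (x : semigroup_power I S) n i :
  spow x n i = spow (x i) n.
Proof. by elim: n => //= n <-. Qed.

Definition completely_regular (S : semigroupType) : Prop :=
  forall a : S, exists b, [/\ a * b = b * a, a * b * a = a & b * a * b = b]%g.

(** * Obstructions in countable powers, and complete regularity *)

Section LocalChange.
Local Open Scope classical_set_scope.
Local Open Scope group_scope.
Variable S : semigroupType.
Hypotheses (S_fin : finite_set [set: S]) (S_dual : dualisable S).

Definition change (e w : S) (s : seq nat) : semigroup_power nat S :=
  fun i => if i \in s then w else e.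

(** The points [change e w [:: k]] converge to the constant [e]. The values of [h] at [change e w
    [:: j; k]] are symmetric in [j] and [k], as [almost_constant_of_swap] requires. *)
Lemma constant_in_subsemigroup (X : set (semigroup_power nat S)) (e w : S)
    (xi : nat -> nat -> semigroup_power nat S) :
  subalgebra X -> (forall k, X (change e w [:: k])) ->
  (forall h : semigroup_power nat S -> S,
     (forall x y, X x -> X y -> h (x * y) = h x * h y) ->
     forall j k l, k != j -> l != j -> k != l -> h (xi j k) = h (xi j l) ->
     h (change e w [:: j; k]) = h (change e w [:: j])) ->
  X (fun=> e).
Proof.
move=> clX zX hX; have [c cP] := finite_bound S_fin.
apply: (limit_in_subsemigroup (c := c.+1) S_dual clX zX) => [i s us|h hM].
  move=> sP; apply: leq_trans (_ : 1%N <= c.+1) => //.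
  rewrite -[1%N]/(size [:: i]); apply: uniq_leq_size => // k /(allP sP).
  by rewrite /change !inE; case: (i =P k) => [->|_]; rewrite eqxx.
apply: (almost_constant_of_swap S_fin (g := fun j k => h (change e w [:: j; k]))
         (xi := fun j k => h (xi j k)) cP).
- by move=> j k; congr h; apply/funext => i; rewrite /change !inE orbC.
- by move=> j k l; exact: (hX h hM).
Qed.

(** The product of [T] or of its dual, so that left and right zero bands are treated together. *)
Definition sided_mul (b : bool) (T : semigroupType) (x y : T) : T :=
  if b then x * y else y * x.

Lemma no_zero_band_with_identity (b : bool) (e f g : S) : let m := @sided_mul b S in
  e * e = e -> e * f = f -> f * e = f -> e * g = g -> g * e = g ->
  f * f = f -> g * g = g -> m f g = f -> m g f = g -> f = g.
Proof.
move=> m ee ef fe eg ge ff gg fg gf.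
have mE x y : m x y = if b then x * y else y * x by [].
have [mee mef mfe mff] : [/\ m e e = e, m e f = f, m f e = f & m f f = f].
  by rewrite !mE; case: (b).
have [meg mge mgg] : [/\ m e g = g, m g e = g & m g g = g] by rewrite !mE; case: (b).
have mi (x y : semigroup_power nat S) i : sided_mul b x y i = m (x i) (y i).
  by rewrite mE /sided_mul; case: (b).
pose X : set (semigroup_power nat S) :=
  [set x | (forall i, x i \in [:: e; f; g]) /\ exists i, x i = g].
have mX x y : X x -> X y -> X (sided_mul b x y).
  move=> [xT [i xi]] [yT _]; split=> [k|].
    rewrite mi; have := yT k; have := xT k; rewrite !inE.
    by case/or3P=> /eqP ->; case/or3P=> /eqP ->;
      rewrite ?(mee, mef, mfe, meg, mge, mff, mgg, fg, gf) eqxx ?orbT.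
  exists i; rewrite mi xi; have := yT i; rewrite !inE.
  by case/or3P=> /eqP ->; rewrite ?(mge, gf, mgg).
have clX : subalgebra X.
  by move=> x y Xx Xy; have := mX _ _ Xx Xy; have := mX _ _ Xy Xx; rewrite /sided_mul; case: (b).
have zX k : X (change f g [:: k]).
  split; last by exists k; rewrite /change inE eqxx.
  by move=> i; rewrite /change !inE; case: ifP => _; rewrite eqxx ?orbT.
pose xi j k : semigroup_power nat S := fun i => if i == j then g else if i == k then e else f.
have xiX j k : X (xi j k).
  split; last by exists j; rewrite /xi eqxx.
  by move=> i; rewrite /xi !inE; do 2?[case: ifP => _]; rewrite eqxx ?orbT.
have [//|_ [_ -> //]] := constant_in_subsemigroup (xi := xi) clX zX.
move=> h hM j k l kj lj kl exi.
have hm x y : X x -> X y -> h (sided_mul b x y) = m (h x) (h y).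
  by move=> Xx Xy; rewrite mE /sided_mul; case: (b); exact: hM.
(* The entry [e] of [xi j k] at [k] lets the [g] of the second factor through, whereas [xi j l] has
   [f] there, which absorbs it. *)
have -> : change f g [:: j; k] = sided_mul b (xi j k) (change f g [:: k]).
  apply/funext => i; rewrite mi /change /xi !inE; have [->|ij] := eqVneq i j.
    by rewrite eq_sym (negPf kj) gf.
  by case: eqP; rewrite ?meg ?mff.
rewrite hm // exi -hm //; congr h; apply/funext => i; rewrite mi /change /xi !inE.
have [->|ij] := eqVneq i j; first by case: ifP; rewrite ?mgg ?gf.
have [->|il] := eqVneq i l; first by rewrite eq_sym (negPf kl) mef.
by case: ifP; rewrite ?fg ?mff.
Qed.

Lemma divides_trans (x y z : S) : divides x y -> divides y z -> divides x z.
Proof.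
move=> [c [d <-]] [c' [d' <-]].
exists (if c' is Some c1 then Some (if c is Some c0 then c1 * c0 else c1) else c).
exists (if d' is Some d1 then Some (if d is Some d0 then d0 * d1 else d1) else d).
by case: c c' d d' => [c|] [c'|] [d|] [d'|] //=; rewrite !mulgA.
Qed.

Lemma dividesMr (x y : S) : divides x (x * y).
Proof. by exists None, (Some y). Qed.

(* Otherwise the sequences having a coordinate not above [e] form an ideal which
   misses the constant [e].  With [w] the idempotent power of [a * e], a homomorphism
   identifying [xi j k] and [xi j l] also identifies [change e w [:: j; k]] and
   [change e w [:: j]], because [a * t = e] while [spow (a * e) n = w]. *)
Lemma power_divides_right_unit (e a t : S) n :
  e * e = e -> e * a = a -> a * t = e -> (forall x : S, spow x n * spow x n = spow x n) ->
  divides (spow (a * e) n) e.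
Proof.
move=> ee ea ate idn; set w := spow _ n; apply: contrapT => we.
have ww : w * w = w by exact: idn.
have ew : e * w = w.
  by rewrite /w; case: (n) => [|m] /=; rewrite !mulgA ea.
have we' : w * e = w.
  by rewrite /w; case: (n) => [|m]; rewrite ?spowSr /= -!mulgA ee.
pose X : set (semigroup_power nat S) := [set x | exists i, ~ divides (x i) e].
have clX : subalgebra X.
  move=> x y [i xi] _; exists i => xyi; apply: xi; apply: divides_trans xyi.
  exact: dividesMr.
have zX s : s != [::] -> X (change e w s).
  by case: s => // k s _; exists k; rewrite /change mem_head.
pose xi j k : semigroup_power nat S := fun i => if i == j then w else if i == k then a else e.
pose up j k : semigroup_power nat S := fun i => if i == j then w else if i == k then t * e else e.
have xiX j k : X (xi j k) by exists j; rewrite /xi eqxx.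
have upX j k : X (up j k) by exists j; rewrite /up eqxx.
suff [i []] : X (fun=> e) by exists None, None.
apply: (constant_in_subsemigroup (xi := xi) (w := w) clX) => [k|h hM j k l kj lj kl exi].
  exact: zX.
have spX x m : X x -> X (spow x m) by move=> Xx; elim: m => //= m IH; apply: clX.
have hP x m : X x -> h (spow x m) = spow (h x) m.
  by move=> Xx; elim: m => //= m IH; rewrite hM ?IH //; exact: spX.
have spid x m : x * x = x :> S -> spow x m = x by move=> xx; elim: m => //= m ->.
(* [h] cannot tell [q] from the same power formed with [xi j l], where [a] meets [t * e] and [change
   e w [:: j]] results. But [q] has the entry [w] at [k], so multiplying by [change e w [:: k]] does
   not alter it. *)
have qX : X (xi j k * up j l) by apply: clX.
pose q := spow (xi j k * up j l) n.
have zq : h (change e w [:: j]) = h q.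
  rewrite hP ?hM // exi -hM // -hP; last exact: clX.
  congr h; apply/funext => i; rewrite /q spow_power.
  have -> : (xi j l * up j l) i = change e w [:: j] i.
    change (xi j l i * up j l i = change e w [:: j] i); rewrite /change /xi /up !inE.
    by do 2?[case: ifP]; rewrite ?mulgA ?ww ?ate ?ee.
  by rewrite /change; case: ifP => _; rewrite spid.
have -> : change e w [:: j; k] = change e w [:: j] * change e w [:: k].
  apply/funext => i.
  change (change e w [:: j; k] i = change e w [:: j] i * change e w [:: k] i).
  rewrite /change !inE; have [->|ij] := eqVneq i j; last by case: ifP; rewrite ?ew ?ee.
  by rewrite eq_sym (negPf kj) we'.
rewrite hM ?zq -?hM; [|exact: spX|exact: zX|exact: zX|exact: zX].
congr h; apply/funext => i.
change (q i * change e w [:: k] i = q i); rewrite /q spow_power.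
change (spow (xi j k i * up j l i) n * change e w [:: k] i = spow (xi j k i * up j l i) n).
rewrite /change /xi /up !inE; have [->|ij] := eqVneq i j.
  by rewrite eq_sym (negPf kj) ww spid ?we'.
have [->|ik] := eqVneq i k; first by rewrite (negPf kl).
by case: (n) => [|m]; rewrite ?spowSr; case: ifP; rewrite -!mulgA ?ee.
Qed.

(** The power of [a * e] starts with [a * a], so the previous lemma yields [a = c * a * (a * d)].
    Iterating this up to an idempotent power of [a * d] gives [a = a * (a * u)], hence
    [a = spow a n * x], and the idempotent [spow a n] fixes [a]. *)
Lemma regular_completely_regular : regular_semigroup S -> completely_regular S.
Proof.
move=> regS a.
suff [b [ab aba]] : exists b, a * b = b * a /\ a * b * a = a.
  have e1 : a * (b * a * b) = a * b by rewrite !mulgA aba.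
  have e2 : b * a * b * a = b * a by rewrite -!mulgA (mulgA a) aba.
  by exists (b * a * b); rewrite e1 e2 aba !mulgA e2.
have [n idn] := finite_idempotent_power S_fin.
have [t ata] := regS a; pose e := a * t.
have ee : e * e = e by rewrite /e mulgA ata.
have [r rE] : exists r, spow (a * e) n = a * a * r.
  by case: (n) => [|m] /=; [exists t | exists (t * spow (a * e) m)]; rewrite /e !mulgA.
have [c [d cd]] : exists c d, c * a * (a * d) = a.
  have [c [d cdE]] := power_divides_right_unit ee ata (erefl e) idn.
  exists (if c is Some c' then e * c' else e).
  exists (if d is Some d' then r * d' * a else r * a).
  have := congr1 (fun x => e * x * a) cdE; rewrite /= ee rE => E.
  by apply: (etrans _ (etrans E ata)); case: c d {cdE E} => [c|] [d|]; rewrite !mulgA.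
have cdm m : spow c m * a * spow (a * d) m = a.
  elim: m => [|m IH]; first exact: cd.
  rewrite (spowSr (a * d)) /=.
  transitivity (c * (spow c m * a * spow (a * d) m) * (a * d)); first by rewrite !mulgA.
  by rewrite IH.
have ap : a * spow (a * d) n = a by rewrite -{1}(cdm n) -mulgA idn cdm.
have [u au] : exists u, a = a * (a * u).
  have [u uE] : exists u, spow (a * d) n = a * u.
    by case: (n) => [|m] /=; [exists d | exists (d * spow (a * d) m)]; rewrite ?mulgA.
  by exists u; rewrite -uE.
have [x ax] : exists x, a = spow a n * x.
  elim: (n) => [|m [x xE]]; first by exists (a * u).
  by exists (x * u); rewrite /= {1}au {2}xE !mulgA.
(* This power has exponent [2n + 1], so its product with [a] is the square of [spow a n]. *)
exists (spow a (n + n)); rewrite -spowSr -[a * _]/(spow a (n + n).+1) -spowD idn.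
by split=> //; rewrite {2 3}ax mulgA idn.
Qed.

End LocalChange.

(** * The bilinear obstruction *)

Section Bilinear.
Import GRing.Theory.
Local Open Scope ring_scope.
Variables (S : semigroupType) (R : comNzRingType) (T : Type).
Variables (s : bool) (D : pred nat) (rho : nat -> nat -> R -> T -> S).

(* Coordinates carry a sign, the first component.  Central parts [r] are eventually
   equal to a constant [n] and their signed deviation from [n] adds up to [- n]; this
   excludes the constant [1], but not the sequences [plus_hole k] that tend to it.
   The auxiliary points [auxp k l] and [auxm k l] are there to make the signed sum of
   [q * p] vanish for the pairs [cross_left], [cross_right], so that multiplication
   preserves this constraint. *)
Definition point : Type := (bool * (nat * option nat))%type.
HB.instance Definition _ := Equality.on point.

Definition plus k : point := (true, (k, None)).
Definition minus l : point := (false, (l, None)).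
Definition auxp k l : point := (true, (k, Some l)).
Definition auxm k l : point := (false, (k, Some l)).

(** A signed sum over infinitely many points, as a limit over finite sets that has to be attained.
    In this form it is additive without mention of supports. *)
Definition eventual_sum (f : point -> R) (v : R) : Prop :=
  exists t0 : seq point, forall t, uniq t -> {subset t0 <= t} ->
    \sum_(i <- t) (if i.1 then f i else - f i) = v.

Lemma eventual_sumD f g v w :
  eventual_sum f v -> eventual_sum g w -> eventual_sum (fun i => f i + g i) (v + w).
Proof.
move=> [t ft] [t' gt]; exists (t ++ t') => t1 ut sub.
have sub1 : {subset t <= t1} by move=> i it; apply: sub; rewrite mem_cat it.
have sub2 : {subset t' <= t1} by move=> i it; apply: sub; rewrite mem_cat it orbT.
rewrite -(ft t1 ut sub1) -(gt t1 ut sub2) -big_split /=.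
by apply: eq_bigr => i _; case: ifP; rewrite ?opprD.
Qed.

Lemma eventual_sum_ext f g v : f =1 g -> eventual_sum f v -> eventual_sum g v.
Proof. by move=> /funext ->. Qed.

Lemma eventual_sum_finite (t : seq point) f :
  uniq t -> (forall i, i \notin t -> f i = 0) ->
  eventual_sum f (\sum_(i <- t) (if i.1 then f i else - f i)).
Proof.
move=> ut f0; exists t => t1 ut1 sub; rewrite (bigID (mem t)) /=.
rewrite [X in _ + X]big1 ?addr0 => [|i /f0 ->]; last by rewrite oppr0 if_same.
rewrite -big_filter; apply: perm_big; apply: uniq_perm => //.
  exact: filter_uniq.
by move=> i; rewrite mem_filter; apply: andb_idr; exact: sub.
Qed.

Definition balanced (q : point -> nat) : Prop :=
  (forall i, D (q i)) /\
  forall k l, (q (plus k) + q (auxp k l) = q (minus l) + q (auxm k l))%N.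

Definition orthogonal_to_balanced (p : point -> nat) : Prop :=
  (forall i, D (p i)) /\
  forall q, balanced q -> eventual_sum (fun i => (q i * p i)%:R) 0.

Definition tail_admissible (r : point -> R) : Prop :=
  exists n, eventual_sum (fun i => r i - n) (- n).

Definition triple (p q : point -> nat) (r : point -> R) :
  semigroup_power (point * T)%type S := fun x => rho (p x.1) (q x.1) (r x.1) x.2.

Definition triples : set (semigroup_power (point * T)%type S) :=
  [set x | exists p q r, [/\ orthogonal_to_balanced p, balanced q,
    tail_admissible r & x = triple p q r]]%classic.

(* For [s = 1] this is the multiplication of [a ^ p * b ^ q * c ^ r] in a group of
   class two; for [s = 0] that of [h ^ p * c ^ r * g ^ q] in a Rees matrix semigroup
   with [g * h = c], where the exponents [p] and [q] are at most [1]. *)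
Hypothesis rhoM : forall p q p' q' r r' t, D p -> D q -> D p' -> D q' ->
  (rho p q r t * rho p' q' r' t)%g =
  rho (p + s * p') (s * q + q') (r + r' + (q * p')%:R) t.
Hypotheses (D0 : D 0%N) (D1 : D 1%N).
Hypothesis DM : forall p q, D p -> D q -> D (p + s * q)%N /\ D (s * p + q)%N.
Hypothesis rho_inj : forall p q r, D p -> D q ->
  (forall t, rho p q r t = rho 0 0 1 t) -> r = 1.
Hypothesis rho_cancel : s -> (forall p, D p) /\ exists N, forall p q r t,
  rho (N.+1 * p) q r t = rho 0 q r t /\ rho p (N.+1 * q) r t = rho p 0 r t.
Hypotheses (S_fin : finite_set [set: S]%classic) (S_dual : dualisable S).

Lemma tripleM p q r p' q' r' :
  orthogonal_to_balanced p -> balanced q -> orthogonal_to_balanced p' -> balanced q' ->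
  (triple p q r * triple p' q' r')%g =
  triple (fun i => p i + s * p' i)%N (fun i => s * q i + q' i)%N
    (fun i => r i + r' i + (q i * p' i)%:R).
Proof.
move=> [Dp _] [Dq _] [Dp' _] [Dq' _]; apply/funext => x.
exact: rhoM.
Qed.

Lemma balancedM q q' : balanced q -> balanced q' -> balanced (fun i => s * q i + q' i)%N.
Proof.
move=> [Dq qE] [Dq' q'E]; split=> [i|k l]; first by case: (DM (Dq i) (Dq' i)).
by rewrite addnACA -mulnDr qE q'E mulnDr addnACA.
Qed.

Lemma orthogonalM p p' : orthogonal_to_balanced p -> orthogonal_to_balanced p' ->
  orthogonal_to_balanced (fun i => p i + s * p' i)%N.
Proof.
move=> [Dp pE] [Dp' p'E]; split=> [i|q bq]; first by case: (DM (Dp i) (Dp' i)).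
have e0 : eventual_sum (fun i => (q i * (s * p' i))%:R) 0.
  case: (s); first by apply: eventual_sum_ext (p'E q bq) => i; rewrite mul1n.
  by exists [::] => t _ _; rewrite big1 // => i _; rewrite mul0n muln0 oppr0 if_same.
rewrite -[0]addr0; apply: eventual_sum_ext (eventual_sumD (pE q bq) e0) => i.
by rewrite mulnDr natrD.
Qed.

Lemma tail_admissibleD r r' f :
  tail_admissible r -> tail_admissible r' -> eventual_sum f 0 ->
  tail_admissible (fun i => r i + r' i + f i).
Proof.
move=> [n rn] [n' rn'] f0; exists (n + n').
rewrite opprD -[X in eventual_sum _ X]addr0.
apply: eventual_sum_ext (eventual_sumD (eventual_sumD rn rn') f0) => i.
by rewrite addrACA [RHS]addrAC.
Qed.

(** The only new contribution to the tail is [q i * p' i], whose signed sum vanishes because [p'] is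
    orthogonal to [q]. *)
Lemma triples_closed : subalgebra triples.
Proof.
move=> _ _ [p [q [r [op bq tr ->]]]] [p' [q' [r' [op' bq' tr' ->]]]].
rewrite tripleM //; do 3!eexists; split; last reflexivity.
- exact: orthogonalM.
- exact: balancedM.
- by apply: tail_admissibleD => //; exact: op'.2.
Qed.

(** Adding a fresh plus point to a stable sum forces [n = 1]; then all deviations vanish and cannot
    add up to [-1]. *)
Lemma constant_not_tail_admissible r : (forall i, r i = 1) -> ~ tail_admissible r.
Proof.
move=> r1 [n [t0 tP]].
pose N := \max_(i <- t0) i.2.1.
have plusN : plus N.+1 \notin undup t0.
  rewrite mem_undup; apply/negP => /(big_rem (plus N.+1)) e.
  have := leqnn N; rewrite {1}/N e /= => h.
  by have := leq_trans (leq_maxl _ _) h; rewrite ltnn.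
have s0 := tP (undup t0) (undup_uniq t0) (fun i it => etrans (mem_undup t0 i) it).
have s1 := tP (plus N.+1 :: undup t0).
move: s1; rewrite /= plusN undup_uniq big_cons s0 r1 /= => s1.
have {s1} n1 : n = 1.
  apply/esym/eqP; rewrite -subr_eq0; apply/eqP; apply: (addIr (- n)).
  rewrite add0r; apply: s1 => // i it; rewrite inE mem_undup it orbT //.
move: s0; rewrite n1 big1 => [/eqP|i _]; last by rewrite r1 subrr oppr0 if_same.
by rewrite eq_sym oppr_eq0 oner_eq0.
Qed.

(** Two ways to give tails near [1] a signed deviation [-1]: lower a plus point, or raise a minus
    point. *)
Definition plus_hole k : point -> R := fun i => 1 - (i == plus k)%:R.
Definition minus_bump l : point -> R := fun i => 1 + (i == minus l)%:R.
Definition cross_left k l : point -> nat :=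
  fun i => (i \in [:: plus k; minus l; auxp k l; auxm k l]).
(** The values at auxiliary points are chosen so that both sides of the balance at [k'], [l'] equal
    [1] if [k' = k] or [l' = l], and [0] otherwise. *)
Definition cross_right k l : point -> nat := fun i => match i with
  | (true, (k', None)) => k' == k
  | (false, (l', None)) => l' == l
  | (true, (k', Some l')) => (k' != k) && (l' == l)
  | (false, (k', Some l')) => (k' == k) && (l' != l)
  end.

Lemma plus_hole_admissible k : tail_admissible (plus_hole k).
Proof.
exists 1; have := @eventual_sum_finite [:: plus k] (fun i => plus_hole k i - 1).
rewrite big_seq1 /= /plus_hole eqxx addrAC subrr add0r; apply=> // i.
by rewrite inE => /negPf ->; rewrite subr0 subrr.
Qed.

Lemma minus_bump_admissible l : tail_admissible (minus_bump l).
Proof.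
exists 1; have := @eventual_sum_finite [:: minus l] (fun i => minus_bump l i - 1).
rewrite big_seq1 /= /minus_bump eqxx addrAC subrr add0r; apply=> // i.
by rewrite inE => /negPf ->; rewrite addr0 subrr.
Qed.

Lemma zero_admissible : tail_admissible (fun=> 0).
Proof. by exists 0, [::] => t _ _; rewrite oppr0 big1 // => i _; rewrite addr0 oppr0 if_same. Qed.

Lemma cross_right_balanced k l : balanced (cross_right k l).
Proof.
have Db (b : bool) : D b by case: b.
split=> [[[] [k' [l'|]]]|k' l'] /=; try exact: Db.
by case: eqP; case: eqP.
Qed.

Lemma balancedZ n q : (forall p, D p) -> balanced q -> balanced (fun i => n * q i)%N.
Proof. by move=> DT [_ qE]; split=> // k l; rewrite -!mulnDr qE. Qed.

Lemma orthogonalZ n p : (forall q, D q) ->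
  orthogonal_to_balanced p -> orthogonal_to_balanced (fun i => n * p i)%N.
Proof.
move=> DT [_ pE]; split=> // q bq.
apply: eventual_sum_ext (pE _ (balancedZ n DT bq)) => i.
by rewrite mulnCA mulnA.
Qed.

Lemma zero_balanced : balanced (fun=> 0%N).
Proof. by []. Qed.

Lemma zero_orthogonal : orthogonal_to_balanced (fun=> 0%N).
Proof.
split=> // q _; exists [::] => t _ _; rewrite big1 // => i _.
by rewrite muln0 oppr0 if_same.
Qed.

(** Pairing with [q] gives exactly the balance equation of [q] at [k] and [l]. *)
Lemma cross_left_orthogonal k l : orthogonal_to_balanced (cross_left k l).
Proof.
have Db (b : bool) : D b by case: b.
split=> [i|q [_ qE]]; first exact: Db.
have := @eventual_sum_finite [:: plus k; minus l; auxp k l; auxm k l]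
  (fun i => (q i * cross_left k l i)%:R).
rewrite !big_cons big_nil /= /cross_left !inE !eqxx ?orbT /= !muln1.
rewrite (_ : _ + _ = 0); first apply.
- by rewrite !xpair_eqE /= !andbF.
- by move=> i /negPf ->; rewrite muln0.
by rewrite addr0 addrA addrACA -opprD -!natrD qE subrr.
Qed.

Lemma cross_same k l i :
  plus_hole k i + (cross_right k l i * cross_left k l i)%:R = minus_bump l i.
Proof.
rewrite /plus_hole /minus_bump /cross_left !inE.
case: i => [[] [k' [l'|]]] /=;
  rewrite !xpair_eqE ?eqxx ?(inj_eq Some_inj) /= ?andbF ?andbT ?orbF ?subr0 ?addr0.
- by case: eqP => _; rewrite ?muln0 ?mul0n addr0.
- by case: eqP => _; rewrite ?subr0 ?addr0 ?subrK.
- by case: eqP => _; case: eqP => _; rewrite ?muln0 ?mul0n addr0.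
- by case: eqP.
Qed.

Lemma cross_distinct k l k' l' i : k != k' -> l != l' ->
  (cross_right k' l' i * cross_left k l i = 0)%N.
Proof.
move=> kk ll; rewrite /cross_left !inE.
case: i => [[] [k1 [l1|]]] /=;
  rewrite !xpair_eqE ?eqxx ?(inj_eq Some_inj) /= ?andbF ?andbT ?orbF /=.
- have [->|] := eqVneq l1 l; last by rewrite andbF muln0.
  by rewrite (negPf ll) andbF.
- have [->|] := eqVneq k1 k; last by rewrite muln0.
  by rewrite (negPf kk).
- have [->|] := eqVneq k1 k; last by rewrite muln0.
  by rewrite (negPf kk).
- have [->|] := eqVneq k1 l; last by rewrite muln0.
  by rewrite (negPf ll).
Qed.

Lemma triples_triple p q r : orthogonal_to_balanced p -> balanced q -> tail_admissible r ->
  triples (triple p q r).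
Proof. by move=> *; exists p, q, r. Qed.

(* [cross_left k l * cross_right k l] is the indicator of [plus k] and [minus l], which
   turns [plus_hole k] into [minus_bump l]; it vanishes for [cross_right k' l']. *)
Lemma hole_eq_bump (h : semigroup_power (point * T)%type S -> S) k l k' l' :
  (forall x y, triples x -> triples y -> h (x * y)%g = (h x * h y)%g) ->
  k != k' -> l != l' ->
  h (triple (fun=> 0%N) (cross_right k l) (fun=> 0)) =
  h (triple (fun=> 0%N) (cross_right k' l') (fun=> 0)) ->
  h (triple (fun=> 0%N) (fun=> 0%N) (plus_hole k)) =
  h (triple (fun=> 0%N) (fun=> 0%N) (minus_bump l)).
Proof.
move=> hM kk ll exi; have tX := triples_triple.
have z0 := zero_admissible; have pk := plus_hole_admissible k.
have ml := minus_bump_admissible l.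
have b0 := zero_balanced; have o0 := zero_orthogonal.
have br := cross_right_balanced; have ol := cross_left_orthogonal k l.
pose p := cross_left k l; pose q := cross_right k l; pose q' := cross_right k' l'.
have bq : balanced q by exact: br.
have bq' : balanced q' by exact: br.
pose sp i := (s * p i)%N.
have step : h (triple sp (fun i => s * q i)%N (minus_bump l)) =
            h (triple sp (fun i => s * q' i)%N (plus_hole k)).
  have -> : triple sp (fun i => s * q i)%N (minus_bump l) =
    (triple (fun=> 0%N) q (fun=> 0%R) * triple p (fun=> 0%N) (plus_hole k))%g.
    rewrite tripleM //; congr triple; apply/funext => i; rewrite ?addn0 //.
    by rewrite add0r -(cross_same k l).
  have -> : triple sp (fun i => s * q' i)%N (plus_hole k) =
    (triple (fun=> 0%N) q' (fun=> 0%R) * triple p (fun=> 0%N) (plus_hole k))%g.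
    rewrite tripleM //; congr triple; apply/funext => i; rewrite ?addn0 //.
    by rewrite add0r cross_distinct // addr0.
  by rewrite !hM ?exi //; apply: tX.
(* For [s = 0] the exponents [p] and [q] have already disappeared; for [s = 1] they remain to be
   cancelled. *)
have [s0|s1] := boolP (~~ s).
  move: step; rewrite /sp (negPf s0) => /esym.
  by rewrite (_ : (fun i => _) = fun=> 0%N) //; apply/funext => i; rewrite mul0n.
have {}s1 : s by rewrite negbK in s1.
have [DT [N cancel]] := rho_cancel s1.
have mul1 (f : point -> nat) : (fun i => s * f i)%N = f.
  by apply/funext => i; rewrite s1 mul1n.
have {}step : h (triple p q (minus_bump l)) = h (triple p q (plus_hole k)).
  rewrite /sp !mul1 in step; rewrite step.
  (* With the factor carrying [q1] on the right there is no cross term, so [exi] exchanges [q'] for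
     [q]. *)
  have mulE q1 : balanced q1 -> triple p q1 (plus_hole k) =
    (triple p (fun=> 0%N) (plus_hole k) * triple (fun=> 0%N) q1 (fun=> 0%R))%g.
    move=> bq1; rewrite tripleM //; congr triple; apply/funext => i.
    - by rewrite muln0 addn0.
    - by rewrite muln0.
    - by rewrite mul0n !addr0.
  by rewrite (mulE q) // (mulE q') // !hM ?exi //; apply: tX.
(* The [N]-fold exponents complete first [p], then [q], to multiples of [N.+1], without touching
   [r]. *)
have clear r : tail_admissible r -> triple (fun=> 0%N) (fun=> 0%N) r =
  (triple (fun=> 0%N) (fun i => N * q i)%N (fun=> 0%R) *
   (triple (fun i => N * p i)%N (fun=> 0%N) (fun=> 0%R) * triple p q r))%g.
  move=> _; apply/funext => x; have [_ c0] := cancel 0%N (q x.1) (r x.1) x.2.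
  have [c1 _] := cancel (p x.1) (q x.1) (r x.1) x.2.
  transitivity (rho 0 (N * q x.1) 0 x.2 *
    (rho (N * p x.1) 0 0 x.2 * rho (p x.1) (q x.1) (r x.1) x.2))%g; last by [].
  rewrite (rhoM (p := N * p x.1)%N) ?DT // s1 !mul1n -mulSnr add0n mul0n add0r addr0 c1.
  by rewrite rhoM ?DT // s1 !mul1n -mulSnr add0r muln0 addr0 c0.
have [oN bN] := (orthogonalZ N DT ol, balancedZ N DT bq).
have tpq r : tail_admissible r -> triples (triple p q r) by move=> tr; apply: tX.
have [tN tN'] : triples (triple (fun=> 0%N) (fun i => N * q i)%N (fun=> 0%R)) /\
  triples (triple (fun i => N * p i)%N (fun=> 0%N) (fun=> 0%R)) by split; apply: tX.
by rewrite !clear // !hM ?step //; try exact: tpq; apply: triples_closed => //; exact: tpq.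
Qed.

(** The [plus_hole k] tend to the constant [1], and [hole_eq_bump] supplies the premise of
    [almost_constant_of_pairs]. So the limit is a triple, and [rho_inj] makes its tail the constant
    [1]. *)
Lemma bilinear_not_dualisable : False.
Proof.
have [c cP] := finite_bound S_fin.
pose z k := triple (fun=> 0%N) (fun=> 0%N) (plus_hole k).
pose z' l := triple (fun=> 0%N) (fun=> 0%N) (minus_bump l).
have [p [q [r [op bq tr e]]]] : triples (fun x => rho 0 0 1 x.2).
  apply: (limit_in_subsemigroup (c := c.+1) (z := z) S_dual triples_closed).
  - move=> k; apply: triples_triple; [exact: zero_orthogonal|exact: zero_balanced|].
    exact: plus_hole_admissible.
  - move=> i; apply: (@sub_small _ _ (fun k => i.1 == plus k)).
      move=> k; apply: contraNT => ik; apply/eqP; rewrite /z /triple /plus_hole.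
      by rewrite (negPf ik) subr0.
    move=> t ut tP; apply: leq_trans (_ : size [:: i.1.2.1] <= _)%N => //.
    by apply: uniq_leq_size => // k /(allP tP) /eqP ->; rewrite inE.
  - move=> h hM.
    have [k l k' l' kk ll|v vP] := almost_constant_of_pairs S_fin (f := fun k => h (z k))
      (g := fun l => h (z' l)) (xi := fun k l => h (triple (fun=> 0%N) (cross_right k l) (fun=> 0)))
      cP.
      exact: hole_eq_bump.
    by exists v; move=> t ut /vP le; apply: leqW; exact: le.
apply: (constant_not_tail_admissible _ tr) => i.
apply: (@rho_inj (p i) (q i)); [exact: op.1|exact: bq.1|] => t.
by have := congr1 (fun f => f (i, t)) e.
Qed.

End Bilinear.

(** * The group of units at an idempotent *)

Section UnitGroup.
Local Open Scope classical_set_scope.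
Local Open Scope group_scope.
Variables (S : semigroupType) (S_fin : finite_set [set: S]) (e : S).

(** For idempotent [e], the units of the monoid [e S e]; [y] may lie outside of it, since
    [e * y * e] is then an inverse too. *)
Definition is_unit_at : set S :=
  [set x | [/\ e * x = x, x * e = x & exists y, x * y = e /\ y * x = e]].

Definition units_at : seq S := [seq x <- sval (cid (finite_enum S_fin)) | `[< is_unit_at x >]].

Lemma mem_units_at x : reflect (is_unit_at x) (x \in units_at).
Proof.
rewrite mem_filter (svalP (cid (finite_enum S_fin)) x) andbT.
exact: asboolP.
Qed.

Hypothesis ee : e * e = e.

Definition unit_group of e * e = e : Type := seq_sub units_at.

HB.instance Definition _ := Finite.on (unit_group ee).

Lemma unit_atM x y : is_unit_at x -> is_unit_at y -> is_unit_at (x * y).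
Proof.
move=> [ex xe [x' [xx' x'x]]] [ey ye [y' [yy' y'y]]]; split.
- by rewrite mulgA ex.
- by rewrite -mulgA ye.
exists (y' * x'); split.
  by rewrite mulgA -(mulgA x) yy' xe.
by rewrite mulgA -(mulgA y') x'x -mulgA ey.
Qed.

Lemma unit_at1 : is_unit_at e.
Proof. by split=> //; exists e. Qed.

Lemma unit_atV x : exists y, is_unit_at x -> is_unit_at y /\ y * x = e.
Proof.
have [[ex xe [y [xy yx]]]|nx] := pselect (is_unit_at x); last by exists e.
exists (e * y * e) => _; split; last by rewrite -mulgA ex -mulgA yx.
split; first by rewrite !mulgA ee.
  by rewrite -mulgA ee.
exists x; split; first by rewrite -mulgA ex -mulgA yx.
by rewrite !mulgA xe xy.
Qed.

Definition unit_val (x : unit_group ee) : S := ssval x.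

Lemma unit_valP x : is_unit_at (unit_val x).
Proof. exact/mem_units_at/ssvalP. Qed.

Definition unit_of x (ux : is_unit_at x) : unit_group ee := SeqSub (introT (mem_units_at x) ux).

Definition unit_mul (x y : unit_group ee) := unit_of (unit_atM (unit_valP x) (unit_valP y)).
Definition unit_one := unit_of unit_at1.
Definition unit_inv (x : unit_group ee) :=
  unit_of (proj1 (svalP (cid (unit_atV (unit_val x))) (unit_valP x))).

Lemma unit_val_inj : injective unit_val.
Proof. exact: val_inj. Qed.

Lemma unit_mulA : associative unit_mul.
Proof. by move=> x y z; apply: unit_val_inj; exact: mulgA. Qed.

Lemma unit_mul1 : left_id unit_one unit_mul.
Proof. by move=> x; apply: unit_val_inj; have [] := unit_valP x. Qed.

Lemma unit_mulV : left_inverse unit_one unit_inv unit_mul.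
Proof.
move=> x; apply: unit_val_inj.
exact: (proj2 (svalP (cid (unit_atV (unit_val x))) (unit_valP x))).
Qed.

HB.instance Definition _ :=
  Finite_isGroup.Build (unit_group ee) unit_mulA unit_mul1 unit_mulV.

Lemma unit_valM : {morph unit_val : x y / x * y}.
Proof. by []. Qed.

End UnitGroup.

(** The last non-trivial term of the lower central series is central and the term before it is not;
    [a] is taken from the latter. *)
Lemma nilpotent_commutator_pair (gT : finGroupType) (P : {group gT}) :
  nilpotent P -> ~~ abelian P ->
  exists a b : gT, [/\ [~ a, b]%g != 1%g, commute a [~ a, b]%g & commute b [~ a, b]%g].
Proof.
move=> nilP; rewrite -nil_class1 -ltnNge.
case En: (nil_class P) => [|[|k]] // _.
have L1 : 'L_k.+3(P)%g = 1%g by apply/(lcn_nil_classP k.+2 nilP); rewrite En.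
have : ~~ ('L_k.+1(P) \subset 'C(P))%g.
  apply/negP => /commG1P; rewrite -lcnSn => /(lcn_nil_classP k.+1 nilP).
  by rewrite En ltnn.
case/subsetPn => a La /centP/existsNP[b /not_implyP[Pb nab]].
have Lc : ([~ a, b] \in 'L_k.+2(P))%g by rewrite lcnSn mem_commg.
have cP : ([~ a, b] \in 'C(P))%g.
  by move/commG1P/fintype.subsetP: L1; apply.
exists a, b; split.
- by apply/negP => /commgP.
- by apply: commute_sym; apply: (centP cP); apply: (fintype.subsetP (lcn_sub _ _)) La.
- by apply: commute_sym; apply: (centP cP).
Qed.

(** * Instances of the bilinear obstruction *)

Section BilinearInstances.
Import GRing.Theory.
Local Open Scope group_scope.
Variable S : semigroupType.
Hypotheses (S_fin : finite_set [set: S]%classic) (S_dual : dualisable S).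

Lemma expg_Zp_nat (gT : finGroupType) (c : gT) n :
  c != 1 -> c ^+ (n%:R%R : 'Z_#[c]) = c ^+ n.
Proof. by move=> c1; rewrite val_Zp_nat ?order_gt1 // expg_mod_order. Qed.

Lemma expg_Zp_eq1 (gT : finGroupType) (c : gT) (r : 'Z_#[c]) :
  c != 1 -> c ^+ r = c -> r = 1%R.
Proof.
move=> c1 cr; apply/eqP; rewrite -(@eq_expg_ord _ c) ?Zp_cast ?order_gt1 //.
by rewrite cr -[X in c == X]expg1 -(expg_Zp_nat 1 c1).
Qed.

Lemma no_class2_commutator (gT : finGroupType) (f : gT -> S) (a b : gT) :
  injective f -> {morph f : x y / x * y} ->
  [~ a, b] != 1 -> commute a [~ a, b] -> commute b [~ a, b] -> False.
Proof.
move=> f_inj fM c1 ac bc.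
(* With this choice of the sign, [b ^+ q * a ^+ p = a ^+ p * b ^+ q * c ^+ (q * p)]. *)
pose c := [~ b, a]; have cE : c = [~ a, b]^-1 by rewrite /c -invg_comm.
have {}c1 : c != 1 by rewrite cE invg_eq1.
have {}ac : commute a c by rewrite cE; apply: commuteV.
have {}bc : commute b c by rewrite cE; apply: commuteV.
(* The two extra coordinates make the exponents of [a] and [b] readable separately, even
   when powers of [a] and [b] are powers of [c]. *)
pose rho p q (r : 'Z_#[c]) (t : option bool) : S := match t with
  | None => f (a ^+ p * b ^+ q * c ^+ r) | Some true => f (a ^+ p) | Some false => f (b ^+ q) end.
apply: (@bilinear_not_dualisable S _ _ true predT rho _ _ _ _ _ _ S_fin S_dual) => //.
- move=> p q p' q' r r' t _ _ _ _.
  rewrite /rho !(mul1n : forall n, (true * n)%N = n).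
  case: t => [[]|]; rewrite -fM; [by rewrite -expgD|by rewrite -expgD|].
  congr f; rewrite !expgD_Zp ?order_gt0 // expg_Zp_nat //.
  have ba : b ^+ q * a ^+ p' = a ^+ p' * b ^+ q * c ^+ (q * p').
    by rewrite -commXXg // -commgC.
  have cX u n m : commute u c -> u ^+ n * c ^+ m = c ^+ m * u ^+ n.
    by move=> uc; apply: commuteX2.
  have cc n m : c ^+ n * c ^+ m = c ^+ m * c ^+ n by rewrite -!expgD addnC.
  rewrite !expgD -!mulgA (mulgA (c ^+ r)) -(cX a) // -(mulgA (a ^+ p')) (mulgA (b ^+ q)) ba.
  rewrite -!mulgA (mulgA (c ^+ r)) -(cX b) // -(mulgA (b ^+ q')) (mulgA (c ^+ (q * p'))).
  by rewrite -(cX b) // -!mulgA (mulgA (c ^+ (q * p'))) cc -mulgA cc.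
- move=> p q r _ _ e; have e1 := f_inj _ _ (e None).
  move: e1 (f_inj _ _ (e (Some true))) (f_inj _ _ (e (Some false))).
  rewrite !expg0 => + ap bq; rewrite ap bq !mul1g => cr.
  by apply: expg_Zp_eq1 => //; rewrite cr.
(* A single [N] has to cancel both exponents, so [N.+1] is a common multiple of the two orders. *)
- split=> //; exists (#[a] * #[b]).-1 => p q r t; rewrite prednK ?muln_gt0 ?order_gt0 //.
  have ap : a ^+ (#[a] * #[b] * p) = 1 by rewrite -mulnA expgM expg_order expg1n.
  have bq : b ^+ (#[a] * #[b] * q) = 1.
    by rewrite -mulnA mulnCA expgM expg_order expg1n.
  by rewrite /rho ap bq !expg0.
Qed.

(** Complete regularity makes [c = g * h] a unit at [e]. If [c] were not [e], the obstruction with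
    [s = 0] would apply. *)
Lemma idempotent_square_product (e g h : S) :
  completely_regular S ->
  e * e = e -> e * g = g -> g * e = e -> h * e = h -> e * h = e -> g * h = e.
Proof.
move=> crS ee eg ge he eh.
have uc : is_unit_at e (g * h).
  split; [by rewrite mulgA eg | by rewrite -mulgA he |].
  have [y [wy wyw ywy]] := crS (h * g).
  have gyh : g * y * h = e.
    transitivity (e * (h * g * y * (h * g)) * e).
      by rewrite !mulgA eh eg -!mulgA ge he.
    by rewrite wyw !mulgA eh -mulgA ge ee.
  exists (g * y * y * h); split.
    transitivity (g * (h * g * y * y) * h); first by rewrite !mulgA.
    by rewrite wy ywy.
  transitivity (g * (y * (y * (h * g))) * h); first by rewrite !mulgA.
  by rewrite -wy (mulgA y) ywy.
pose c : unit_group S_fin ee := unit_of S_fin ee uc.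
have cE : unit_val c = g * h by [].
have [c1|c1] := eqVneq c 1; first by rewrite -cE c1.
(* [e] stands for the zeroth powers of [h] and [g]. *)
pose l p := if p is 0 then e else h; pose r q := if q is 0 then e else g.
pose rho p q (i : 'Z_#[c]) (t : unit) := l p * (unit_val (c ^+ i) * r q).
have eu u : e * unit_val (u : unit_group S_fin ee) = unit_val u by have [] := unit_valP u.
have ue u : unit_val (u : unit_group S_fin ee) * e = unit_val u by have [] := unit_valP u.
have el p : e * l p = e by case: p.
have re q : r q * e = e by case: q.
have rl p q : (p <= 1)%N -> (q <= 1)%N -> r q * l p = unit_val (c ^+ (q * p)).
  by case: p q => [|[|]] // [|[|]] // _ _ /=; rewrite ?expg1 ?expg0 ?ee ?eh ?ge.
exfalso; apply: (@bilinear_not_dualisable S _ _ false (leq^~ 1%N) rho _ _ _ _ _ _ S_fin S_dual)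
  => //.
- move=> p q p' q' i i' t _ q1 p1' _; rewrite /rho.
  rewrite !expgD_Zp ?order_gt0 // expg_Zp_nat //.
  have cc n m : c ^+ n * c ^+ m = c ^+ m * c ^+ n by rewrite -!expgD addnC.
  rewrite -(mulgA (c ^+ i)) (cc i') !unit_valM -rl //.
  by rewrite (addn0 p : p + false * p' = p)%N (add0n q' : false * q + q' = q')%N -!mulgA.
- by move=> p q; rewrite addn0.
- move=> p q i _ _ /(_ tt) /(congr1 (fun x => e * x * e)); rewrite /rho.
  rewrite [c ^+ (1%R : 'Z_#[c])](expg_Zp_nat 1 c1) expg1 /= => e1.
  apply: expg_Zp_eq1 => //; apply: unit_val_inj; move: e1.
  rewrite -!mulgA re ee !ue !mulgA el ee !eu.
  by rewrite eg -mulgA he.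
Qed.

End BilinearInstances.

(** * Idempotents and unit parts in the completely regular case *)

Section Structure.
Local Open Scope classical_set_scope.
Local Open Scope group_scope.
Local Open Scope quotient_scope.
Variable S : semigroupType.
Hypotheses (S_fin : finite_set [set: S]) (S_dual : dualisable S).
Variable inv : S -> S.
Hypotheses (invC : forall x, x * inv x = inv x * x) (mulVKx : forall x, x * inv x * x = x)
  (invKx : forall x, inv x * x * inv x = inv x).

(** The identity of the maximal subgroup containing [x]. *)
Definition unit_part (x : S) : S := x * inv x.
Local Notation o := unit_part.

Lemma unit_partMl x : o x * x = x. Proof. exact: mulVKx. Qed.

Lemma unit_partMr x : x * o x = x. Proof. by rewrite /o invC mulgA mulVKx. Qed.

Lemma unit_partK x : o x * o x = o x. Proof. by rewrite {2}/o mulgA unit_partMl. Qed.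

Lemma unit_part_unique e x y : x * e = x -> x * y = e -> o x = e.
Proof.
move=> xe xy; transitivity (o x * e); first by rewrite {2}/o -/(o x) /o invC -mulgA xe.
by rewrite -xy mulgA unit_partMl.
Qed.

Lemma unit_part_id e : e * e = e -> o e = e.
Proof. by move=> ee; exact: (unit_part_unique ee ee). Qed.

Lemma unit_part_inv x : o (inv x) = o x.
Proof.
apply: (@unit_part_unique _ _ x); last by rewrite -invC.
by rewrite /o mulgA invKx.
Qed.

Lemma completely_regularS : completely_regular S.
Proof. by move=> x; exists (inv x). Qed.

(* With [k] the unit part of [e * f], apply [idempotent_square_product] to [k * e R k L f * k]. *)
Lemma idempotentM (e f : S) : e * e = e -> f * f = f -> e * f * (e * f) = e * f.
Proof.
move=> ee ff; pose k := o (e * f).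
have ek : e * k = k by rewrite /k /o !mulgA ee.
have kf : k * f = k by rewrite /k /o invC -!mulgA ff.
have kk : k * k = k by exact: unit_partK.
have /= := @idempotent_square_product _ S_fin S_dual k (k * e) (f * k) completely_regularS kk.
rewrite mulgA kk -(mulgA k e) ek kk -(mulgA f) kk (mulgA k f) kf kk => /(_ erefl erefl erefl erefl).
rewrite -(mulgA k e) (mulgA e f) (unit_partMr (e * f)) unit_partMl => {1}->.
exact: unit_partMl.
Qed.

(** [f * g * f] is R-related to [f * g] and L-related to [g * f], which makes it the link between
    the two. *)
Lemma idempotent_products_related (f g : S) : f * f = f -> g * g = g ->
  [/\ f * g * (f * g * f) = f * g * f, f * g * f * (f * g) = f * g,
      f * g * f * (g * f) = f * g * f & g * f * (f * g * f) = g * f].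
Proof.
move=> ff gg; have fgK := idempotentM ff gg; have gfK := idempotentM gg ff; split.
- by rewrite mulgA fgK.
- by rewrite mulgA -(mulgA (f * g)) ff -mulgA fgK.
- by transitivity (f * (g * f * (g * f))); [rewrite !mulgA | rewrite gfK mulgA].
- by rewrite !mulgA -(mulgA g f f) ff -mulgA gfK.
Qed.

(** [f * g] and [f * g * f] form a right zero band below [e], [f * g * f] and [g * f] a left zero
    band; both collapse. *)
Lemma local_idempotentsC (e f g : S) : e * e = e -> f * f = f -> g * g = g ->
  e * f = f -> f * e = f -> e * g = g -> g * e = g -> f * g = g * f.
Proof.
move=> ee ff gg ef fe eg ge.
have [r1 r2 l1 l2] := idempotent_products_related ff gg.
have fgK := idempotentM ff gg; have gfK := idempotentM gg ff.
have fgfK := idempotentM fgK ff.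
have [lf rf] : e * (f * g * f) = f * g * f /\ f * g * f * e = f * g * f.
  by split; [rewrite !mulgA ef | rewrite -mulgA fe].
transitivity (f * g * f).
  apply: (no_zero_band_with_identity S_fin S_dual (b := false) (e := e)) => //=.
    by rewrite mulgA ef.
  by rewrite -mulgA ge.
apply/esym; apply: (no_zero_band_with_identity S_fin S_dual (b := true) (e := e)) => //=.
  by rewrite mulgA eg.
by rewrite -mulgA fe.
Qed.

(** The unit parts of [x * f] and [f * x] lie below [e] and so commute with [f], whence
    [x * f = f * x * f = f * x]. *)
Lemma local_idempotent_central (e f x : S) : e * e = e -> f * f = f ->
  e * f = f -> f * e = f -> e * x = x -> x * e = x -> x * f = f * x.
Proof.
move=> ee ff ef fe ex xe; pose k := o (x * f); pose k' := o (f * x).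
have kf : k * f = k by rewrite /k /o invC -!mulgA ff.
have ek : e * k = k by rewrite /k /o !mulgA ex.
have ke : k * e = k by rewrite -kf -mulgA fe.
have fk' : f * k' = k' by rewrite /k' /o !mulgA ff.
have k'e : k' * e = k' by rewrite /k' /o invC -!mulgA xe.
have ek' : e * k' = k' by rewrite -fk' mulgA ef.
have fk : f * k = k by rewrite (local_idempotentsC ee ff (unit_partK _)).
have k'f : k' * f = k' by rewrite -(local_idempotentsC ee ff (unit_partK (f * x))).
transitivity (f * x * f).
  by rewrite -mulgA -{2}(unit_partMl (x * f)) mulgA fk unit_partMl.
by rewrite -{1}(unit_partMr (f * x)) -mulgA k'f unit_partMr.
Qed.

Lemma sandwich_le (e f : S) : e * e = e -> e * (e * f * e) = e * f * e /\ e * f * e * e = e * f * e.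
Proof. by move=> ee; split; rewrite ?mulgA ?ee // -!mulgA ee. Qed.

(** Since [a] commutes with [e * f * e] and [b] with [f * e * f], the element
    [inv b * inv a * (e * f)] meets the conditions of [unit_part_unique] for [a * b] and [e * f]. *)
Lemma unit_partM a b : o (a * b) = o a * o b.
Proof.
set e := o a; set f := o b.
have [ee ff] : e * e = e /\ f * f = f by split; exact: unit_partK.
have efK := idempotentM ee ff.
have [ae ea] : a * e = a /\ e * a = a by split; [exact: unit_partMr | exact: unit_partMl].
have [bf fb] : b * f = b /\ f * b = b by split; [exact: unit_partMr | exact: unit_partMl].
have efeC : a * (e * f * e) = e * f * e * a.
  have [l r] := sandwich_le f ee.
  by apply: (local_idempotent_central ee) => //; exact: idempotentM.
have fefC : b * (f * e * f) = f * e * f * b.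
  have [l r] := sandwich_le e ff.
  by apply: (local_idempotent_central ff) => //; apply: idempotentM => //; exact: idempotentM.
have ei : e * inv a = inv a by rewrite /e /o invC invKx.
have [eE fE] : a * inv a = e /\ b * inv b = f by [].
clearbody e f.
apply: (@unit_part_unique _ _ (inv b * inv a * (e * f))).
  have bef : b * (e * f) = f * e * f * b.
    by rewrite -fefC !mulgA bf.
  transitivity (a * (e * f * (e * f)) * b); first by rewrite -mulgA bef !mulgA ae.
  by rewrite efK !mulgA ae -mulgA fb.
have afa : a * f * inv a = e * f * e.
  transitivity (a * (e * f * e) * inv a); first by rewrite !mulgA ae -!mulgA ei.
  by rewrite efeC -mulgA eE -mulgA ee.
transitivity (a * (b * inv b) * inv a * (e * f)); first by rewrite !mulgA.
by rewrite fE afa -(mulgA (e * f)) (mulgA e e) ee efK.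
Qed.

(** Sandwiching by [e] preserves the R-relation, and idempotents below [e] commute, so related ones
    coincide. *)
Lemma local_eq_of_R (e x y : S) : e * e = e -> x * x = x -> y * y = y ->
  x * y = y -> y * x = x -> e * x * e = e * y * e.
Proof.
move=> ee xx yy xy yx.
have step u v : u * u = u -> v * v = v -> u * v = v -> e * u * e * (e * v * e) = e * v * e.
  move=> uu vv uv; transitivity (e * u * (e * u) * v * e).
    by rewrite -[in LHS]uv -!mulgA (mulgA e e) ee.
  by rewrite (idempotentM ee uu) -(mulgA e u) uv.
have := local_idempotentsC ee (idempotentM (idempotentM ee xx) ee)
  (idempotentM (idempotentM ee yy) ee).
have [-> ->] := sandwich_le x ee; have [-> ->] := sandwich_le y ee.
by rewrite !step // => ->.
Qed.

Lemma local_eq_of_L (e x y : S) : e * e = e -> x * x = x -> y * y = y ->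
  x * y = x -> y * x = y -> e * x * e = e * y * e.
Proof.
move=> ee xx yy xy yx.
have step u v : u * u = u -> v * v = v -> u * v = u -> e * u * e * (e * v * e) = e * u * e.
  move=> uu vv uv; transitivity (e * (u * (v * e * (v * e)))).
    by rewrite -[in LHS]uv -!mulgA (mulgA e e) ee.
  by rewrite (idempotentM vv ee) !mulgA -(mulgA e u) uv.
have := local_idempotentsC ee (idempotentM (idempotentM ee xx) ee)
  (idempotentM (idempotentM ee yy) ee).
have [-> ->] := sandwich_le x ee; have [-> ->] := sandwich_le y ee.
by rewrite !step // => ->.
Qed.

(** [f * g * f] links [f * g] to [g * f] through R and L, and sandwiching by [e] turns both
    relations into equality. *)
Lemma idempotents_normal (e f g : S) : e * e = e -> f * f = f -> g * g = g ->
  e * f * g * e = e * g * f * e.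
Proof.
move=> ee ff gg; have fgK := idempotentM ff gg; have gfK := idempotentM gg ff.
have [r1 r2 l1 l2] := idempotent_products_related ff gg.
have fgfK := idempotentM fgK ff.
transitivity (e * (f * g) * e); first by rewrite !mulgA.
rewrite (@local_eq_of_R e (f * g) (f * g * f)) // (@local_eq_of_L e _ (g * f)) //.
by rewrite !mulgA.
Qed.

(** Normality turns [e * p * (k * q) * e] into [e * k * (q * p * e)], which the idempotent [e * k]
    fixes from the left. *)
Lemma sandwich_idempotent (e k p q : S) : e * e = e -> k * k = k -> p * p = p -> q * q = q ->
  e = p * k * q -> e * k * e = e.
Proof.
move=> ee kk pp qq eE; have kqK := idempotentM kk qq; have ekK := idempotentM ee kk.
have e1 : e = e * k * (q * p * e).
  rewrite -[LHS]ee -{1}ee {2}eE -(mulgA p) !(mulgA e) (idempotents_normal ee pp kqK).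
  by rewrite !mulgA.
by rewrite {2}e1 mulgA ekK -e1.
Qed.

(** [unit_part] is multiplicative, and [o x] can replace an empty factor. *)
Lemma divides_unit_part (x y : S) : divides x y ->
  exists p q, [/\ p * p = p, q * q = q & o y = p * o x * q].
Proof.
have oK := unit_partK.
move=> [[c|] [[d|] <-]]; rewrite ?unit_partM.
- by exists (o c), (o d).
- by exists (o c), (o x); rewrite -(mulgA (o c)) !oK.
- by exists (o x), (o d); rewrite !oK.
- by exists (o x), (o x); rewrite !oK.
Qed.

Lemma J_class_unit_parts (a s : S) : J_class a s ->
  o a * o s * o a = o a /\ o s * o a * o s = o s.
Proof.
move=> [/divides_unit_part[p [q [pp qq e]]] /divides_unit_part[p' [q' [pp' qq' e']]]].
by split; [apply: sandwich_idempotent e' | apply: sandwich_idempotent e]; rewrite ?unit_partK.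
Qed.

(** * The congruence of equal unit parts, and Sylow subgroups *)

Definition unit_part_eq (a b : S) : bool := o a == o b.

Lemma unit_part_eq_equiv : equiv_class_of unit_part_eq.
Proof.
split; [by move=> a; exact: eqxx | by move=> a b; exact: eq_sym |].
by move=> b a c /eqP ab /eqP bc; rewrite /unit_part_eq ab bc.
Qed.

Lemma unit_part_eqM (x x' y y' : S) : EquivRelPack unit_part_eq_equiv x x' ->
  EquivRelPack unit_part_eq_equiv y y' ->
  EquivRelPack unit_part_eq_equiv (x * y) (x' * y').
Proof.
by rewrite /= /unit_part_eq !unit_partM => /eqP -> /eqP ->.
Qed.

Definition unit_part_congruence : congruence S := Congruence unit_part_eqM.

Lemma is_normal_band_of_groups : normal_band_of_groups S.
Proof.
exists unit_part_congruence; split.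
  move=> a; split.
    move=> x y /eqP ax /eqP ay; apply/eqP.
    by rewrite /= unit_partM -ax -ay unit_partK.
  exists (o a); first by apply/eqP; rewrite (unit_part_id (unit_partK a)).
  move=> x /eqP ax; rewrite ax unit_partMl unit_partMr; split=> //.
  exists (inv x); last by split=> //; rewrite -invC.
  by apply/eqP; rewrite ax unit_part_inv.
pose Q := quotient_semigroup unit_part_congruence.
pose pi (a : S) : Q := \pi_({eq_quot unit_part_congruence}) a.
have piE (u : Q) : exists a, u = pi a by exists (repr u); rewrite /pi reprK.
have mulE a b : pi a * pi b = pi (a * b) := quotient_mul_pi _ _ _.
have pi_eq a b : o a = o b -> pi a = pi b.
  by move=> ab; apply/eqP; rewrite eqmodE; apply/eqP.
split.
  by move=> u; have [a ->] := piE u; rewrite mulE; apply: pi_eq; rewrite unit_partM unit_partK.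
move=> u v w; have [[a ->] [b ->] [c ->]] := And3 (piE u) (piE v) (piE w).
rewrite (mulE a b) (mulE a c) (mulE _ c) (mulE _ b) (mulE (a * b * c)) (mulE (a * c * b)).
by apply: pi_eq; rewrite !unit_partM idempotents_normal ?unit_partK.
Qed.

Lemma unit_group_abelian_sylows (e : S) (ee : e * e = e) :
  abelian_sylows (unit_group S_fin ee).
Proof.
move=> p P _ sylP; apply: contrapT => /negP nab.
have nilP := pgroup_nil (pHall_pgroup sylP).
have [a [b [c1 ac bc]]] := nilpotent_commutator_pair nilP nab.
exact: (no_class2_commutator S_fin S_dual (@unit_val_inj _ _ _ ee) (@unit_valM _ _ _ ee) c1 ac bc).
Qed.

(** * Coordinates on a J-class *)

Section JClass.
Variables a e : S.
Hypothesis eE : o a = e.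

Lemma unit_part_idem : e * e = e. Proof. by rewrite -eE unit_partK. Qed.
Local Notation ee := unit_part_idem.

(** The idempotents L-related to [e]; with the dual [R_idempotents] they index a Rees matrix
    representation. *)
Definition L_idempotents : set S := [set x | x * e = x /\ e * x = e].
Definition R_idempotents : set S := [set y | e * y = y /\ y * e = e].

Definition J_class_map
    (z : semigroup_prod (rectangle L_idempotents R_idempotents) (unit_group S_fin ee)) : S :=
  val z.1.1 * unit_val z.2 * val z.1.2.

(** By [idempotent_square_product] every entry [y * x'] of the sandwich matrix is [e]. *)
Lemma J_class_map_hom : is_hom J_class_map.
Proof.
move=> [[x y] g] [[x' y'] g'].
change (val x * (unit_val g * unit_val g') * val y' =
  val x * unit_val g * val y * (val x' * unit_val g' * val y')).
have [[ey ye] [x'e ex']] : R_idempotents (val y) /\ L_idempotents (val x').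
  by split; exact: set_valP.
have yx' : val y * val x' = e.
  exact: (idempotent_square_product S_fin S_dual completely_regularS ee).
have [_ ge _] := unit_valP g.
by rewrite !mulgA -(mulgA _ (val y)) yx' -(mulgA (val x) _ e) ge.
Qed.

Lemma J_class_mapK z : e * J_class_map z * e = unit_val z.2.
Proof.
case: z => [[x y] g]; rewrite /J_class_map /=.
have [[ey ye] [xe ex]] : R_idempotents (val y) /\ L_idempotents (val x).
  by split; exact: set_valP.
have [eg ge _] := unit_valP g.
by rewrite !mulgA ex eg -mulgA ye ge.
Qed.

Lemma J_class_map_inj : injective J_class_map.
Proof.
move=> z z' zz'.
have gg' : z.2 = z'.2 by apply: unit_val_inj; rewrite -!J_class_mapK zz'.
move: z z' zz' gg' => [[x y] g] [[x' y'] g'] /= zz' gg'; subst g'.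
have [[ey ye] [xe ex]] : R_idempotents (val y) /\ L_idempotents (val x).
  by split; exact: set_valP.
have [[ey' ye'] [xe' ex']] : R_idempotents (val y') /\ L_idempotents (val x').
  by split; exact: set_valP.
have [eg ge _] := unit_valP g.
have gV : unit_val g * unit_val g^-1 = e by rewrite -unit_valM mulgV.
have Vg : unit_val g^-1 * unit_val g = e by rewrite -unit_valM mulVg.
have -> : x = x'.
  apply: val_inj; have := congr1 (fun w => w * e * unit_val g^-1) zz'.
  rewrite /J_class_map /= -!mulgA (mulgA (val y)) (mulgA (val y')) ye ye'.
  by rewrite !mulgA -!(mulgA _ (unit_val g) e) ge -!mulgA gV xe xe'.
have -> // : y = y'.
apply: val_inj; have := congr1 (fun w => unit_val g^-1 * (e * w)) zz'.
rewrite /J_class_map /= !mulgA -!(mulgA _ e (val _)) ex ex'.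
by rewrite -!(mulgA _ e (unit_val g)) eg Vg ey ey'.
Qed.

(** An element [s] with unit part [k] has the coordinates [k * e], [e * s * e] and [e * k], because
    [k * e * k = k]. *)
Lemma J_class_map_iso : iso_onto J_class_map (J_class a).
Proof.
split; first exact: J_class_map_hom.
split; last 2 first.
- by move=> z z' _ _; exact: J_class_map_inj.
- move=> s Js; have [] := J_class_unit_parts Js; rewrite eE.
  have [k kE] : exists k, o s = k by exists (o s).
  rewrite kE => eke kek; have kk : k * k = k by rewrite -kE unit_partK.
  have sE : k * s * k = s by rewrite -kE unit_partMl unit_partMr.
  have Lx : L_idempotents (k * e) by split; rewrite ?mulgA // -mulgA ee.
  have Ry : R_idempotents (e * k) by split; rewrite ?mulgA ?ee.
  have Ug : is_unit_at e (e * s * e).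
    have oe : o (e * s * e) = e by rewrite !unit_partM (unit_part_id ee) kE.
    split; [by rewrite !mulgA ee | by rewrite -mulgA ee |].
    by exists (inv (e * s * e)); split; rewrite -?invC; exact: oe.
  pose x : L_idempotents := exist _ (k * e) (mem_set Lx).
  pose y : R_idempotents := exist _ (e * k) (mem_set Ry).
  exists ((x, y), unit_of S_fin ee Ug) => //.
  change (k * e * (e * s * e) * (e * k) = s).
  transitivity (k * e * k * s * (k * e * k)); last by rewrite kek sE.
  rewrite -[in LHS]sE !mulgA -(mulgA k e e) ee.
  by rewrite -(mulgA _ e e) ee.
move=> z _; have zK := J_class_mapK z; move: z zK => [[x y] g] /= zK.
have [[ey ye] [xe ex]] : R_idempotents (val y) /\ L_idempotents (val x).
  by split; exact: set_valP.
have [eg ge _] := unit_valP g.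
have Vg : unit_val g^-1 * unit_val g = e by rewrite -unit_valM mulVg.
have Va : inv a * a = e by rewrite -invC; exact: eE.
split.
  exists (Some (val x * unit_val g * inv a)), (Some (val y)).
  by rewrite /J_class_map /= -(mulgA _ (inv a)) Va -(mulgA (val x)) ge.
exists (Some (a * unit_val g^-1 * e)), (Some e); rewrite /=.
set w := J_class_map _ in zK *; rewrite -(mulgA _ e w) -(mulgA _ (e * w)) zK.
by rewrite -mulgA Vg -eE unit_partMr.
Qed.

End JClass.

Lemma J_class_rectangular_group (a : S) :
  exists (B : semigroupType) (gT : finGroupType) (f : semigroup_prod B gT -> S),
    [/\ rectangular_band B, abelian_sylows gT & iso_onto f (J_class a)].
Proof.
exists (rectangle (L_idempotents (o a)) (R_idempotents (o a))).
exists (unit_group S_fin (unit_part_idem (erefl (o a)))).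
exists (J_class_map (eE := erefl (o a))); split.
- do 2!eexists; exists id; split=> //; split=> // x _; exists x => //.
- exact: unit_group_abelian_sylows.
- exact: J_class_map_iso.
Qed.

End Structure.

Theorem corollary7p3 (S : semigroupType)
  (S_finite : finite_set [set: S]%classic)
  (S_dualisable : dualisable S)
  (S_regular : regular_semigroup S) :
  normal_band_of_groups S /\
  forall a : S,
    exists (B : semigroupType) (gT : finGroupType)
      (f : semigroup_prod B gT -> S),
      [/\ rectangular_band B, abelian_sylows gT & iso_onto f (J_class a)].
Proof.
have [inv invP] := choice (regular_completely_regular S_finite S_dualisable S_regular).
have invC x : (x * inv x = inv x * x)%g by have [] := invP x.
have mulVKx x : (x * inv x * x = x)%g by have [] := invP x.
have invKx x : (inv x * x * inv x = inv x)%g by have [] := invP x.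
split; first exact: (is_normal_band_of_groups S_finite S_dualisable invC mulVKx invKx).
exact: (J_class_rectangular_group S_finite S_dualisable invC mulVKx invKx).
Qed.
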